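(* Let $D$ be a symplectic double groupoid with side groupoids $V \rightrightarrows M$ and $H \rightrightarrows M$, let $X := \widetilde r_H^{-1}(1^V M) \subseteq D$, and let $X^\perp$ be the characteristic foliation of the coisotropic submanifold $X$. Then for every $s \in X$, the leaf of the foliation $X^\perp$ containing $s$ is given by $$X^\perp_s := \{\, s \,\widetilde\circ_H\, \widetilde 1^V_\lambda \ |\ \lambda \in \ell_H^{-1}(m)\,\},$$ where $m = r_V(\widetilde r_H(s))$.
   Context: Groupoid conventions: a groupoid $G \rightrightarrows B$ has source $r$, target $\ell$, unit map $b \mapsto 1_b$, inverse $i$, and product $g \circ h$, defined exactly when $r(g) = \ell(h)$, with $\ell(g\circ h) = \ell(g)$ and $r(g \circ h) = r(h)$. A double Lie groupoid is a manifold $D$ with Lie groupoid structures $D \rightrightarrows V$ (the top groupoid) and $D \rightrightarrows H$ (the left groupoid), together with Lie groupoids $V \rightrightarrows M$ (right) and $H \rightrightarrows M$ (bottom), such that the structure maps of the top and bottom groupoids are homomorphisms between the left and right groupoids, and vice versa. It is also assumed that the double source map $D \to H \times_M V$, $d \mapsto (\widetilde r_V(d), \widetilde r_H(d))$ (fiber product over the source maps of $H$ and $V$) is a surjective submersion. Notation for structure maps: the structure maps of $V \rightrightarrows M$ are $r_V, \ell_V, 1^V, i_V, \circ_V$; those of $H \rightrightarrows M$ are $r_H, \ell_H, 1^H, i_H, \circ_H$. The structure maps of the left groupoid $D \rightrightarrows H$ are $\widetilde r_V, \widetilde \ell_V, \widetilde 1^V, \widetilde i_V, \widetilde\circ_V$,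 and those of the top groupoid $D \rightrightarrows V$ are $\widetilde r_H, \widetilde \ell_H, \widetilde 1^H, \widetilde i_H, \widetilde\circ_H$. For example $\widetilde 1^V : H \to D$ and $\widetilde r_H : D \to V$, and $\ell_V \circ \widetilde r_H = r_H \circ \widetilde \ell_V$, $\widetilde r_H(\widetilde 1^V_\lambda) = 1^V_{r_H(\lambda)}$, etc. A symplectic double groupoid is a double Lie groupoid $D$ equipped with a symplectic form $\omega$ making both $D \rightrightarrows V$ and $D \rightrightarrows H$ symplectic groupoids. The set $1^V M \subseteq V$ is the unit submanifold of $V \rightrightarrows M$; it is coisotropic for the Poisson structure on $V$ induced by the symplectic groupoid $D \rightrightarrows V$, so $X = \widetilde r_H^{-1}(1^V M)$ is a coisotropic submanifold of $D$. The characteristic foliation of a coisotropic submanifold $N$ of a symplectic manifold $(D,\omega)$ is the foliation $N^\perp$ of $N$ integrating the distribution $\ker(\omega|_N) = (TN)^{\omega} \subset TN$ (the symplectic orthogonal of $TN$).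
   Formalization: The formal theorem additionally assumes that the fibre ℓ_H^{-1}(m) is connected for the given s; without this the displayed set is not connected and so is not a leaf (e.g. D = T^*K with K a disconnected Lie group, H = K, M a point). *)

(* Defs.v *)
From HB Require Import structures.
From mathcomp Require Import all_boot all_order all_algebra.
From mathcomp Require Import all_classical all_reals.
From mathcomp Require Import topology normedtype derive.
Set Implicit Arguments.
Unset Strict Implicit.
Unset Printing Implicit Defensive.
Import Order.TTheory GRing.Theory Num.Theory.
Import numFieldNormedType.Exports.
Local Open Scope classical_set_scope.
Local Open Scope ring_scope.

(* C^k on an open subset U of a finite-dimensional normed space. *)
Fixpoint Ck_on (R : realType) (E F : normedModType R) (k : nat) (U : set E)
    (f : E -> F) : Prop :=
  match k with
  | 0%N => {in U, continuous f}
  | k'.+1 => (forall x, U x -> differentiable f x) /\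
             forall v : E, Ck_on k' U (fun x => 'd f x v)
  end.

Definition smooth_on (R : realType) (E F : normedModType R) (U : set E)
  (f : E -> F) : Prop := forall k, Ck_on k U f.

(* A coordinate chart on the open set [dom]; [param] is the inverse of [coord],
   and is only meaningful on the image [chart_image]. *)
Record chart (R : realType) (T : topologicalType) (n : nat) := Chart {
  dom : set T;
  coord : T -> 'rV[R]_n;
  param : 'rV[R]_n -> T }.

Definition chart_image (R : realType) (T : topologicalType) n
  (c : chart R T n) : set 'rV[R]_n := coord c @` dom c.

Definition is_chart (R : realType) (T : topologicalType) n (c : chart R T n) :
    Prop :=
  [/\ open (dom c), open (chart_image c), {in dom c, continuous (coord c)},
      {in chart_image c, continuous (param c)} &
      forall x, dom c x -> param c (coord c x) = x].

(* Smooth manifolds without boundary, of pure dimension [mdim] (possibly 0),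
   Hausdorff and second countable.  As T_p we take 'rV[R]_mdim, a tangent
   vector at p being represented by its coordinates in the chart
   [chart_at p]. *)
Record manifold (R : realType) := Manifold {
  carrier :> topologicalType;
  mdim : nat;
  atlas : set (chart R carrier mdim);
  chart_at : carrier -> chart R carrier mdim;
  manifold_hausdorff : hausdorff_space carrier;
  manifold_countable : @second_countable carrier;
  atlas_chart : forall c, atlas c -> is_chart c;
  atlas_smooth : forall c d, atlas c -> atlas d ->
    smooth_on (coord c @` (dom c `&` dom d)) (coord d \o param c);
  chart_at_atlas : forall p, atlas (chart_at p);
  chart_at_dom : forall p, dom (chart_at p) p }.

Notation "'Tsp' M" := 'rV_(mdim M) (at level 10).

Section Smooth.
Variable R : realType.
Implicit Types M N P : manifold R.

Definition loc M (p : M) : M -> Tsp M := coord (chart_at p).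

Definition smooth M N (f : M -> N) : Prop :=
  continuous f /\
  forall c d, atlas c -> atlas d ->
    smooth_on (coord c @` (dom c `&` f @^-1` dom d))
      (coord d \o f \o param c).

(* The tangent map T_p f. *)
Definition tmap M N (f : M -> N) (p : M) : Tsp M -> Tsp N :=
  'd (loc (f p) \o f \o param (chart_at p)) (loc p p).

Definition submersion M N (f : M -> N) : Prop :=
  smooth f /\ forall p (w : Tsp N), exists u, tmap f p u = w.

Definition smooth_curve M (g : R -> M) : Prop :=
  continuous g /\
  forall c, atlas c -> smooth_on (g @^-1` dom c) (coord c \o g).

Definition velocity M (g : R -> M) (t : R) : Tsp M :=
  derive1 (loc (g t) \o g) t.

(* The tangent space at p of an (embedded) submanifold X of M. *)
Definition tangent M (X : set M) (p : M) : set (Tsp M) :=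
  [set u | exists g : R -> M,
     [/\ smooth_curve g, forall t, X (g t), g 0 = p & velocity g 0 = u]].

(* F is a smooth extension, in coordinates around (p, q), of the map f defined
   on the subset A of M x N. *)
Definition local_extension M N P (A : set (M * N)) (f : M -> N -> P)
    (p : M) (q : N) (F : Tsp M * Tsp N -> Tsp P) : Prop :=
  (exists2 U, open_nbhs (loc p p, loc q q) U & smooth_on U F) /\
  \forall z \near (p, q), A z ->
    dom (chart_at (f p q)) (f z.1 z.2) /\
    loc (f p q) (f z.1 z.2) = F (loc p z.1, loc q z.2).

(* Smoothness of a map defined on a submanifold A of M x N. *)
Definition smooth_on_pairs M N P (A : set (M * N)) (f : M -> N -> P) : Prop :=
  forall p q, A (p, q) -> exists F, local_extension A f p q F.

(* Fields of bilinear forms on the tangent spaces, given by Gram matrices. *)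
Definition tensor2 M := M -> 'M[R]_(mdim M).

Definition ev M (w : tensor2 M) (p : M) (u v : Tsp M) : R :=
  (u *m w p *m v^T) 0 0.

(* The coefficient of w on the constant vector fields u, v of the chart c. *)
Definition pull M (w : tensor2 M) (c : chart R M (mdim M)) (u v : Tsp M)
    (x : Tsp M) : R :=
  let p := param c x in
  let J := 'd (loc p \o param c) x in ev w p (J u) (J v).

(* Differential 2-forms. *)
Definition two_form M (w : tensor2 M) : Prop :=
  (forall p u, ev w p u u = 0) /\
  forall c u v, atlas c -> smooth_on (chart_image c) (pull w c u v).

Definition closed_form M (w : tensor2 M) : Prop :=
  forall c u1 u2 u3 x, atlas c -> chart_image c x ->
    'd (pull w c u2 u3) x u1 + 'd (pull w c u3 u1) x u2 +
    'd (pull w c u1 u2) x u3 = 0.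

Definition symplectic M (w : tensor2 M) : Prop :=
  [/\ two_form w, closed_form w &
      forall p u, (forall v, ev w p u v = 0) -> u = 0].

(* ker (w|_X), the characteristic distribution of X. *)
Definition characteristic M (w : tensor2 M) (X : set M) (p : M) : set (Tsp M) :=
  [set u | tangent X p u /\ forall v, tangent X p v -> ev w p u v = 0].

(* L is the image of a connected immersed submanifold of M, contained in X,
   whose tangent spaces are given by the distribution E. *)
Definition integral_manifold M (X : set M) (E : forall p : M, set (Tsp M))
    (L : set M) : Prop :=
  L `<=` X /\
  exists (L0 : manifold R) (j : L0 -> M),
    [/\ connected [set: L0], smooth j, injective j, range j = L &
        forall y, injective (tmap j y) /\ range (tmap j y) = E (j y)].

(* L is the leaf through p of the foliation of X integrating E, i.e. the
   largest connected integral manifold containing p. *)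
Definition is_leaf M (X : set M) (E : forall p : M, set (Tsp M)) (p : M)
    (L : set M) : Prop :=
  [/\ integral_manifold X E L, L p &
      forall L', integral_manifold X E L' -> L' p -> L' `<=` L].

End Smooth.

(* [product g h] is only meaningful when [source g = target h]. *)
Record lie_groupoid (R : realType) (G B : manifold R) := LieGroupoid {
  source : G -> B;
  target : G -> B;
  unit_map : B -> G;
  inverse : G -> G;
  product : G -> G -> G;
  src_unit : forall b, source (unit_map b) = b;
  tgt_unit : forall b, target (unit_map b) = b;
  src_mul : forall g h, source g = target h -> source (product g h) = source h;
  tgt_mul : forall g h, source g = target h -> target (product g h) = target g;
  mul_assoc : forall g h k, source g = target h -> source h = target k ->
    product g (product h k) = product (product g h) k;
  mul_unit_left : forall g, product (unit_map (target g)) g = g;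
  mul_unit_right : forall g, product g (unit_map (source g)) = g;
  src_inv : forall g, source (inverse g) = target g;
  tgt_inv : forall g, target (inverse g) = source g;
  mul_inv_right : forall g, product g (inverse g) = unit_map (target g);
  mul_inv_left : forall g, product (inverse g) g = unit_map (source g);
  src_submersion : submersion source;
  tgt_submersion : submersion target;
  unit_smooth : smooth unit_map;
  inv_smooth : smooth inverse;
  mul_smooth :
    smooth_on_pairs [set z : G * G | source z.1 = target z.2] product }.

Section Groupoids.
Variable R : realType.

Definition composable (G B : manifold R) (Q : lie_groupoid G B) : set (G * G) :=
  [set z | source Q z.1 = target Q z.2].

(* m^* w = pr_1^* w + pr_2^* w on the manifold of composable pairs, whose
   tangent space at (g, h) is {(u, u') | T source u = T target u'}. *)
Definition multiplicative (G B : manifold R) (Q : lie_groupoid G B)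
    (w : tensor2 G) : Prop :=
  forall (g h : G) F, source Q g = target Q h ->
    local_extension (composable Q) (product Q) g h F ->
    forall u u' v v',
      tmap (source Q) g u = tmap (target Q) h u' ->
      tmap (source Q) g v = tmap (target Q) h v' ->
      let dF := 'd F (loc g g, loc h h) in
      ev w (product Q g h) (dF (u, u')) (dF (v, v')) = ev w g u v + ev w h u' v'.

Definition symplectic_groupoid (G B : manifold R) (Q : lie_groupoid G B)
  (w : tensor2 G) : Prop := symplectic w /\ multiplicative Q w.

Definition groupoid_hom (G B G' B' : manifold R) (Q : lie_groupoid G B)
    (Q' : lie_groupoid G' B') (F : G -> G') (f : B -> B') : Prop :=
  [/\ smooth F /\ smooth f,
      forall g, source Q' (F g) = f (source Q g) /\
                target Q' (F g) = f (target Q g),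
      forall b, F (unit_map Q b) = unit_map Q' (f b),
      forall g, F (inverse Q g) = inverse Q' (F g) &
      forall g h, source Q g = target Q h ->
        F (product Q g h) = product Q' (F g) (F h)].

Section Double.
Variables D H V M : manifold R.

(* The product of t : D => V is a homomorphism over the product of b : H => M,
   from the groupoid D x_V D => H x_M H with structure maps induced by
   l : D => H, to l. *)
Definition mul_hom (t : lie_groupoid D V) (b : lie_groupoid H M)
    (l : lie_groupoid D H) : Prop :=
  [/\ forall d e, source t d = target t e ->
        source l (product t d e) = product b (source l d) (source l e) /\
        target l (product t d e) = product b (target l d) (target l e),
      forall x y, source b x = target b y ->
        unit_map l (product b x y) = product t (unit_map l x) (unit_map l y),
      forall d e, source t d = target t e ->
        inverse l (product t d e) = product t (inverse l d) (inverse l e) &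
      forall d e d' e',
        source t d = target t e -> source t d' = target t e' ->
        source l d = target l d' -> source l e = target l e' ->
        product l (product t d e) (product t d' e') =
        product t (product l d d') (product l e e')].

End Double.

Definition structure_homs (D H V M : manifold R) (t : lie_groupoid D V)
    (b : lie_groupoid H M) (l : lie_groupoid D H) (r : lie_groupoid V M) :
    Prop :=
  [/\ groupoid_hom l r (source t) (source b),
      groupoid_hom l r (target t) (target b),
      groupoid_hom r l (unit_map t) (unit_map b),
      groupoid_hom l l (inverse t) (inverse b) &
      mul_hom t b l].

(*            top
         D ======> V
    left ||        || right
         H ======> M
           bottom
   The maps carrying a tilde and an index V (resp. H) in the literature are
   those of [left_gpd] (resp. [top_gpd]); those without tilde are those of
   [right_gpd] (index V) and [bottom_gpd] (index H). *)
Record double_lie_groupoid (D H V M : manifold R) := DoubleLieGroupoid {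
  left_gpd : lie_groupoid D H;
  top_gpd : lie_groupoid D V;
  right_gpd : lie_groupoid V M;
  bottom_gpd : lie_groupoid H M;
  top_homs : structure_homs top_gpd bottom_gpd left_gpd right_gpd;
  left_homs : structure_homs left_gpd right_gpd top_gpd bottom_gpd;
  double_src_surj : forall h v, source bottom_gpd h = source right_gpd v ->
    exists d, source left_gpd d = h /\ source top_gpd d = v;
  (* T_(h,v) (H x_M V) = {(u, u') | T source u = T source u'}. *)
  double_src_submersion : forall d u u',
    tmap (source bottom_gpd) (source left_gpd d) u =
    tmap (source right_gpd) (source top_gpd d) u' ->
    exists z,
      tmap (source left_gpd) d z = u /\ tmap (source top_gpd) d z = u' }.

Definition symplectic_double_groupoid (D H V M : manifold R)
    (Q : double_lie_groupoid D H V M) (w : tensor2 D) : Prop :=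
  symplectic_groupoid (top_gpd Q) w /\ symplectic_groupoid (left_gpd Q) w.

Definition unit_preimage (D H V M : manifold R)
    (Q : double_lie_groupoid D H V M) : set D :=
  source (top_gpd Q) @^-1` range (unit_map (right_gpd Q)).

End Groupoids.

(* Main.v *)
From Pilot Require Import Defs.
From HB Require Import structures.
From mathcomp Require Import all_boot all_order all_algebra.
From mathcomp Require Import all_classical all_reals interval_inference.
From mathcomp Require Import topology normedtype landau derive sequences.
From mathcomp Require Import ring lra.
(* Gives coord its meaning for charts again, rather than that of coordinates in a basis. *)
Import Pilot.Defs.
Set Implicit Arguments.
Unset Strict Implicit.
Unset Printing Implicit Defensive.
Import Order.TTheory GRing.Theory Num.Theory.
Import numFieldNormedType.Exports.
Local Open Scope classical_set_scope.
Local Open Scope ring_scope.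

(** Let r be the source map of the top groupoid D => V. On X, where r takes values in the units of
    V, the elements 1^V_x with x in H act by right translation in the top groupoid, and the claim
    is that the leaf of s is the orbit of s, that is the set of all s 1^V_x with x in H of target
    m, where r s = 1_m. Two facts prove it.

    First, the orbit is an integral manifold of the characteristic distribution. The fibre of the
    target map of H over m is a manifold ([fibre_submanifold]), connected by assumption, and
    x |-> s 1^V_x immerses it injectively in D, as x is recovered from s 1^V_x by the source map
    to H and a left translation. A vector tangent to the orbit at p is the product of 0_p with a
    vector tangent to the units 1^V H, while a vector v tangent to X is the product of v with a vector tangent to
    1^V H as well, because the double units 1^V 1^H and 1^H 1^V coincide. The form being
    multiplicative and vanishing on units, the two vectors are orthogonal ([leaf_orthogonal]).
    Thus the tangent space of the orbit lies in the orthogonal of TX, and equality follows from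
    dimensions ([leaf_tangent]): both V and H have half the dimension of D
    ([symplectic_groupoid_dim]), so mdim H - mdim M is the codimension of X. The tangent spaces of
    X are found by lifting curves through the submersion r ([tangent_preimage_section]).

    Second, the orbit is the largest connected integral manifold through s. The orbits are the
    fibres of a map defined on X, d |-> d 1^V_(h^-1) where h is the source of d in H ([shrink]).
    Its tangent map vanishes on the tangent spaces of the orbits, which are the characteristic
    spaces, hence it is constant on every connected integral manifold ([tmap0_constant]).

    The analytic input is the smooth inverse function theorem ([inverse_function]), through the
    straightening of submersions ([submersion_straighten]): it gives the charts of the fibres and
    the lifts of curves. Smoothness at a point is handled through germs ([smooth_at]) and tangent
    maps through a chain rule in charts ([msmooth_comp], and [msmooth_pairs] for the partially
    defined products of groupoids). *)

(** * Maps of class C^k between finite-dimensional spaces *)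

(** Joins completeness with the norm: rows form a Banach space, in which contractions have
    fixed points. *)
HB.instance Definition _ (R : realType) n := NormedModule.on 'rV[R]_n.

Section Calculus.
Variable R : realType.
Implicit Types E F G : normedModType R.

Lemma near_eq_continuous (S T : topologicalType) (f g : S -> T) x :
  (\forall y \near x, f y = g y) -> {for x, continuous f} -> {for x, continuous g}.
Proof.
move=> fg cf; have fgx := nbhs_singleton fg.
rewrite /prop_for /continuous_at -fgx; apply: cvg_trans cf; exact: near_eq_cvg.
Qed.

Lemma near_all E (P : E -> Prop) (x : E) : (forall y, P y) -> \forall y \near x, P y.
Proof. by move=> PE; apply: filterS (@filterT _ (nbhs x) _) => y _; exact: PE. Qed.

Lemma near_refl E F (g : E -> F) (x : E) : \forall z \near x, g z = g z.
Proof. exact: near_all. Qed.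

Lemma near_eq_is_diff E F (f g : E -> F) x :
  (\forall y \near x, f y = g y) -> differentiable f x ->
  differentiable g x /\ 'd g x = 'd f x :> (E -> F).
Proof.
move=> fg df; have fgx : f x = g x := nbhs_singleton fg.
have gd : g \o shift x = cst (g x) + 'd f x +o_ 0 id.
  apply/eqaddoP => e e0; have /diff_locally/eqaddoP/(_ e e0) := df.
  have : \forall h \near (0 : E), f (h + x) = g (h + x).
    by have := fg; rewrite (near_shift 0 x) subr0.
  by move=> near_fg; apply: filterS2 near_fg => h /= eq_h; rewrite !fctE /= eq_h fgx.
have dE : 'd g x = 'd f x :> (E -> F) by exact: diff_unique (diff_continuous df) gd.
split=> //; apply/diff_locallyP; rewrite dE; split=> //.
exact: diff_continuous.
Qed.

Lemma Ck_on_continuous E F k (U : set E) (f : E -> F) x :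
  Ck_on k U f -> U x -> {for x, continuous f}.
Proof.
case: k => [/= cf Ux|k [df _] Ux]; first by apply: cf; rewrite inE.
exact/differentiable_continuous/df.
Qed.

Lemma Ck_onS E F k (U : set E) (f : E -> F) : Ck_on k.+1 U f <->
  (forall x, U x -> differentiable f x) /\ forall v, Ck_on k U (fun x => 'd f x v).
Proof. by []. Qed.

Lemma Ck_onW E F k (U : set E) (f : E -> F) : Ck_on k.+1 U f -> Ck_on k U f.
Proof.
elim: k f => [|k IH] f [df dfk]; first by move=> x /[!inE] Ux; exact/differentiable_continuous/df.
by split=> // v; apply: IH.
Qed.

Lemma Ck_on_sub E F k (U V : set E) (f : E -> F) :
  V `<=` U -> Ck_on k U f -> Ck_on k V f.
Proof.
move=> VU; elim: k f => [|k IH] f.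
  by move=> cf x /[!inE] /VU Ux; apply: cf; rewrite inE.
by move=> /Ck_onS[df dfk]; split=> [x /VU/df|v]; [|exact: IH (dfk v)].
Qed.

(** The set has to be open: a differential sees the values around a point, not only on [U]. *)
Lemma Ck_on_ext E F k (U : set E) (f g : E -> F) : open U ->
  (forall x, U x -> f x = g x) -> Ck_on k U f -> Ck_on k U g.
Proof.
move=> oU.
have near_eq (h l : E -> F) x : (forall y, U y -> h y = l y) -> U x -> \forall y \near x, h y = l y.
  by move=> hl Ux; near=> y; apply: hl; near: y; exact: open_nbhs_nbhs.
elim: k f g => [|k IH] f g fg; have nfg x := near_eq f g x fg.
  move=> cf x /[!inE] Ux; apply: near_eq_continuous (nfg x Ux) _.
  by apply: cf; rewrite inE.
move=> /Ck_onS[df dfk]; split=> [x Ux|v]; first by case: (near_eq_is_diff (nfg x Ux) (df x Ux)).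
apply: IH (dfk v) => x Ux.
by case: (near_eq_is_diff (nfg x Ux) (df x Ux)) => _ ->.
Unshelve. all: by end_near. Qed.

Lemma Ck_cst E F k (U : set E) (a : F) : Ck_on k U (fun _ : E => a).
Proof.
elim: k a => [|k IH] a; first by move=> x _; exact: cst_continuous.
split=> [x _|v]; first exact: differentiable_cst.
by rewrite (_ : (fun x => _) = (fun=> 0))//; apply: funext => x; rewrite diff_cst.
Qed.

Lemma Ck_linear E F k (U : set E) (f : {linear E -> F}) :
  continuous f -> Ck_on k U f.
Proof.
move=> cf; case: k => [|k]; first by move=> x _; exact: cf.
split=> [x _|v]; first exact: linear_differentiable.
rewrite (_ : (fun x => _) = (fun=> f v)); first exact: Ck_cst.
by apply: funext => x; rewrite diff_lin.
Qed.

Lemma Ck_linear_comp E F G k (U : set E) (f : E -> F) (l : {linear F -> G}) :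
  continuous l -> open U -> Ck_on k U f -> Ck_on k U (l \o f).
Proof.
move=> cl oU; elim: k f => [|k IH] f.
  by move=> cf x Ux; apply: continuous_comp; [exact: cf | exact: cl].
have dl y : differentiable l y by exact: linear_differentiable.
move=> /Ck_onS[df dfk]; split=> [x Ux|v]; first by apply: differentiable_comp => //; exact: df.
apply: Ck_on_ext (IH _ (dfk v)) => // x Ux /=.
by have := diff_comp (df x Ux) (dl (f x)); rewrite diff_lin// => ->.
Qed.

Lemma CkD E F k (U : set E) (f g : E -> F) : open U ->
  Ck_on k U f -> Ck_on k U g -> Ck_on k U (fun x => f x + g x).
Proof.
move=> oU; elim: k f g => [|k IH] f g.
  by move=> cf cg x Ux; apply: continuousD; [exact: cf | exact: cg].
move=> /Ck_onS[df dfk] /Ck_onS[dg dgk]; split=> [x Ux|v].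
  by apply: differentiableD; [exact: df | exact: dg].
apply: Ck_on_ext (IH _ _ (dfk v) (dgk v)) => // x Ux /=.
by rewrite diffD//; [exact: df | exact: dg].
Qed.

Lemma Ck_sum E F k (U : set E) (I : Type) (r : seq I) (f : I -> E -> F) : open U ->
  (forall i, Ck_on k U (f i)) -> Ck_on k U (fun x => \sum_(i <- r) f i x).
Proof.
move=> oU fi; elim: r => [|i r IH].
  by rewrite (_ : (fun x => _) = (fun=> 0)); [exact: Ck_cst|apply: funext => x; rewrite big_nil].
rewrite (_ : (fun x => _) = (fun x => f i x + \sum_(i <- r) f i x)).
  exact: CkD.
by apply: funext => x; rewrite big_cons.
Qed.

Lemma Ck_pair E F G k (U : set E) (f : E -> F) (g : E -> G) : open U ->
  Ck_on k U f -> Ck_on k U g -> Ck_on k U (fun x => (f x, g x)).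
Proof.
move=> oU; elim: k f g => [|k IH] f g.
  by move=> cf cg x Ux; apply: cvg_pair; [exact: cf | exact: cg].
move=> /Ck_onS[df dfk] /Ck_onS[dg dgk]; split=> [x Ux|v].
  by apply: differentiable_pair; [exact: df | exact: dg].
apply: Ck_on_ext (IH _ _ (dfk v) (dgk v)) => // x Ux /=.
by rewrite diff_pair//; [exact: df | exact: dg].
Qed.

Lemma scale_is_bilinear E :
  bilinear_for
    (GRing.Scale.Law.clone _ _ *:%R _) (GRing.Scale.Law.clone _ _ *:%R _)
    (@GRing.scale R E).
Proof.
split=> [u'|u] a x y /=; first by rewrite scalerDl scalerA.
by rewrite scalerDr !scalerA mulrC.
Qed.
HB.instance Definition _ E := bilinear_isBilinear.Build R R E E _ _
  (@GRing.scale R E) (@scale_is_bilinear E).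

Lemma diff_scale E F (k : E -> R) (f : E -> F) x :
  differentiable k x -> differentiable f x ->
  differentiable (fun y => k y *: f y) x /\
  'd (fun y => k y *: f y) x = (fun v => k x *: 'd f x v + 'd k x v *: f x) :> (E -> F).
Proof.
move=> dk df.
have cb : continuous (fun p : R * F => p.1 *: p.2) by exact: scale_continuous.
have db := @differentiable_bilin _ _ _ _ (@GRing.scale R F) (k x, f x) cb.
have dp := differentiable_pair dk df.
split; first exact: (differentiable_comp dp db).
have := diff_comp dp db; rewrite diff_bilin// diff_pair// => ->.
Qed.

Lemma CkZ E F k (U : set E) (c : E -> R) (f : E -> F) : open U ->
  Ck_on k U c -> Ck_on k U f -> Ck_on k U (fun x => c x *: f x).
Proof.
move=> oU; elim: k c f => [|k IH] c f.
  by move=> cf cg x Ux; apply: continuousZ; [exact: cf | exact: cg].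
move=> ck1 fk1; have ck := Ck_onW ck1; have fk := Ck_onW fk1.
move: ck1 fk1 => /Ck_onS[dc dck] /Ck_onS[df dfk]; split=> [x Ux|v].
  by case: (diff_scale (dc x Ux) (df x Ux)).
apply: (@Ck_on_ext _ _ _ _ (fun x => c x *: 'd f x v + 'd c x v *: f x)) => // [x Ux|].
  by case: (diff_scale (dc x Ux) (df x Ux)) => _ ->.
by apply: CkD => //; apply: IH.
Qed.

Lemma CkM E k (U : set E) (f g : E -> R) : open U ->
  Ck_on k U f -> Ck_on k U g -> Ck_on k U (fun x => f x * g x).
Proof. exact: CkZ. Qed.

Lemma Ck_prod E k (U : set E) (I : Type) (r : seq I) (f : I -> E -> R) : open U ->
  (forall i, Ck_on k U (f i)) -> Ck_on k U (fun x => \prod_(i <- r) f i x).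
Proof.
move=> oU fi; elim: r => [|i r IH].
  by rewrite (_ : (fun x => _) = (fun=> 1)); [exact: Ck_cst|apply: funext => x; rewrite big_nil].
rewrite (_ : (fun x => _) = (fun x => f i x * \prod_(i <- r) f i x)).
  exact: CkM.
by apply: funext => x; rewrite big_cons.
Qed.

Lemma CkV E k (U : set E) (f : E -> R) : open U -> (forall x, U x -> f x != 0) ->
  Ck_on k U f -> Ck_on k U (fun x => (f x)^-1).
Proof.
move=> oU f0; elim: k => [|k IH] fk1.
  by move=> x /[!inE] Ux; apply: continuousV; [exact: f0 | apply: fk1; rewrite inE].
have fk := IH (Ck_onW fk1).
move: fk1 => /Ck_onS[df dfk]; split=> [x Ux|v].
  by apply: differentiableV; [exact: df | exact: f0].
apply: (@Ck_on_ext _ _ _ _ (fun x => (-1 * ((f x)^-1 * (f x)^-1)) * 'd f x v)) => // [x Ux|].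
  rewrite diffV//; [|exact: df|exact: f0].
  by rewrite /= /GRing.scale/= mulN1r expr2 invfM.
by apply: CkM => //; apply: CkM => //; [exact: Ck_cst | apply: CkM].
Qed.

(** Finite dimension in the form of a basis [b] and its continuous coordinates [phi]. This is
    what the chain rule needs to be iterated, see [Ck_comp]. *)
Definition fin_dim E := exists n (b : 'I_n -> E) (phi : 'I_n -> {linear E -> R}),
  (forall i, continuous (phi i)) /\ forall w, w = \sum_i phi i w *: b i.

(** The differential of g o f at x along v involves x through the point f x and through the
    vector 'd f x v. Expanding the vector in coordinates separates the two: what remains is a
    sum of products of functions of x, to which the induction hypothesis applies. *)
Lemma Ck_comp E F G k (U : set E) (V : set F) (f : E -> F) (g : F -> G) :
  fin_dim F -> open U -> open V -> (forall x, U x -> V (f x)) ->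
  Ck_on k U f -> Ck_on k V g -> Ck_on k U (g \o f).
Proof.
move=> [n [b [phi [cphi phiE]]]] oU oV UV; elim: k f g UV => [|k IH] f g UV.
  move=> cf cg x Ux; apply: continuous_comp; first exact: cf.
  by apply: cg; move: Ux; rewrite !inE; exact: UV.
move=> fk1; have fk := Ck_onW fk1; move: fk1 => /Ck_onS[df dfk] /Ck_onS[dg dgk]; split=> [x Ux|v].
  by apply: differentiable_comp; [exact: df | apply: dg; exact: UV].
apply: (@Ck_on_ext _ _ _ _ (fun x => \sum_i (phi i \o (fun x => 'd f x v)) x *:
    ((fun y => 'd g y (b i)) \o f) x)) => // [x Ux|].
  rewrite diff_comp//=; [|exact: df|apply: dg; exact: UV].
  by rewrite [in RHS](phiE ('d f x v)) linear_sum; apply: eq_bigr => i _; rewrite linearZ.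
apply: Ck_sum => // i; apply: CkZ => //; first exact: Ck_linear_comp.
exact: IH.
Qed.

End Calculus.

Section FiniteDimension.
Variable R : realType.
Implicit Types E F G : normedModType R.

Lemma fin_dim_R : fin_dim (R : normedModType R).
Proof.
exists 1%N, (fun=> 1), (fun=> idfun); split=> [i x|w]; first exact: cvg_id.
by rewrite big_ord1 /GRing.scale/= mulr1.
Qed.

Definition row_coord n (i : 'I_n) (v : 'rV[R]_n) : R := v 0 i.

Lemma row_coord_linear n (i : 'I_n) : linear (row_coord i).
Proof. by move=> a u v; rewrite /row_coord !mxE. Qed.
HB.instance Definition _ n i := GRing.isLinear.Build R 'rV[R]_n R _
  (@row_coord n i) (@row_coord_linear n i).

Lemma fin_dim_rV n : fin_dim ('rV[R]_n : normedModType R).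
Proof.
exists n, (fun i => delta_mx 0 i), (fun i => @row_coord n i : {linear _ -> _}).
split=> [i|w]; first exact: coord_continuous.
exact: row_sum_delta.
Qed.

Lemma fin_dim_prod E F : fin_dim E -> fin_dim F -> fin_dim (E * F)%type.
Proof.
move=> [n [b [phi [cphi phiE]]]] [m [c [psi [cpsi psiE]]]].
exists (n + m)%N, (fun k => match fintype.split k with inl i => (b i, 0) | inr j => (0, c j) end).
exists (fun k => match fintype.split k with
  | inl i => (phi i \o fst : {linear _ -> _})
  | inr j => (psi j \o snd : {linear _ -> _}) end).
split=> [k|w].
  case: (fintype.split k) => i x /=.
    by apply: continuous_comp; [exact: cvg_fst | exact: cphi].
  by apply: continuous_comp; [exact: cvg_snd | exact: cpsi].
rewrite big_split_ord/=.
under eq_bigr => i _ do rewrite (unsplitK (inl _)).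
under [X in _ + X]eq_bigr => i _ do rewrite (unsplitK (inr _)).
rewrite [LHS]surjective_pairing {1}(phiE w.1) {1}(psiE w.2).
have -> : \sum_i phi i w.1 *: ((b i, 0) : E * F) = (\sum_i phi i w.1 *: b i, 0).
  rewrite [RHS]surjective_pairing/=; apply: (@eq_trans _ _ (\sum_i (phi i w.1 *: b i, 0))).
    by apply: eq_bigr => i _; congr (_, _); rewrite /= scaler0.
  by elim/big_ind2 : _ => // x1 x2 y1 y2 -> ->; congr (_, _); rewrite /= addr0.
have -> : \sum_i psi i w.2 *: ((0, c i) : E * F) = (0, \sum_i psi i w.2 *: c i).
  apply: (@eq_trans _ _ (\sum_i (0, psi i w.2 *: c i))).
    by apply: eq_bigr => i _; congr (_, _); rewrite /= scaler0.
  by elim/big_ind2 : _ => // x1 x2 y1 y2 -> ->; congr (_, _); rewrite /= addr0.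
by congr (_, _); rewrite /= ?addr0 ?add0r.
Qed.

Lemma fin_dim_continuous E F (f : {linear E -> F}) : fin_dim E -> continuous f.
Proof.
move=> [n [b [phi [cphi phiE]]]].
have -> : f = (fun w => \sum_i phi i w *: f (b i)) :> (E -> F).
  by apply: funext => w; rewrite {1}(phiE w) linear_sum; apply: eq_bigr => i _; rewrite linearZ.
apply: continuous_big => [|i _ x]; first exact: pseudometric_normed_Zmodule.add_continuous.
by apply: (@continuousZ _ _ _ (phi i) (fun=> f (b i))); [exact: cphi | exact: cst_continuous].
Qed.

End FiniteDimension.

(** * Germs of smooth maps *)

Section Germs.
Variable R : realType.
Implicit Types E F G : normedModType R.

(** Smoothness on some neighbourhood. This is a property of the germ of [f], and it is stable
    under composition without any domain to keep track of. *)
Definition smooth_at E F (f : E -> F) (x : E) := exists2 U, open_nbhs x U & smooth_on U f.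

Lemma Ck_on_points E F k (U : set E) (f : E -> F) :
  Ck_on k U f <-> forall x, U x -> Ck_on k [set x] f.
Proof.
split=> [fU x Ux|]; first by apply: Ck_on_sub fU => _ ->.
elim: k f => [|k IH] f fU.
  by move=> x /[!inE] Ux; apply: (fU x Ux); rewrite inE.
split=> [x /fU/Ck_onS[df _]|v]; first exact: df.
by apply: IH => x /fU/Ck_onS[_]; exact.
Qed.

(** What allows a map to be checked smooth with a different local expression around each point. *)
Lemma smooth_on_germ E F (U : set E) (f : E -> F) : open U ->
  smooth_on U f <-> forall x, U x -> smooth_at f x.
Proof.
move=> oU; split=> [fU x Ux|fU k]; first by exists U.
apply/Ck_on_points => x /fU[V [oV Vx] fV].
by apply: Ck_on_sub (fV k) => _ ->.
Qed.

Lemma smooth_at_near E F (f : E -> F) x : smooth_at f x -> \forall y \near x, smooth_at f y.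
Proof.
move=> [U [oU Ux] fU]; near=> y; exists U => //; split=> //.
by near: y; exact: open_nbhs_nbhs.
Unshelve. all: by end_near. Qed.

Lemma smooth_at_diff E F (f : E -> F) x : smooth_at f x -> differentiable f x.
Proof. by move=> [U [oU Ux] fU]; have /Ck_onS[+ _] := fU 1; exact. Qed.

Lemma smooth_at_cont E F (f : E -> F) x : smooth_at f x -> {for x, continuous f}.
Proof. by move=> /smooth_at_diff; exact: differentiable_continuous. Qed.

Lemma smooth_at_ext E F (f g : E -> F) x : (\forall y \near x, f y = g y) ->
  smooth_at f x -> smooth_at g x.
Proof.
rewrite -nbhs_nearE nbhsE => -[V [oV Vx] fg] [U [oU Ux] fU].
exists (U `&` V) => [|k]; first by split; [exact: openI|].
apply: (@Ck_on_ext _ _ _ _ _ f); first exact: openI.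
  by move=> y [_ /fg].
by apply: Ck_on_sub (fU k) => y [].
Qed.

Lemma smooth_at_cst E F (a : F) x : smooth_at (fun _ : E => a) x.
Proof. by exists setT => [|k]; [split=> //; exact: openT | exact: Ck_cst]. Qed.

Lemma smooth_at_linear E F (f : {linear E -> F}) x : continuous f -> smooth_at f x.
Proof. by move=> cf; exists setT => [|k]; [split=> //; exact: openT | exact: Ck_linear]. Qed.

Lemma smooth_at_lin E F (f : {linear E -> F}) x : fin_dim E -> smooth_at f x.
Proof. by move=> fd; apply: smooth_at_linear; exact: fin_dim_continuous. Qed.

Lemma smooth_at_id E x : smooth_at (fun x : E => x) x.
Proof. by apply: (@smooth_at_linear _ _ idfun) => y; exact: cvg_id. Qed.

Lemma smooth_at2 E F1 F2 F3 (f : E -> F1) (g : E -> F2) (h : E -> F3) x :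
  (forall k U, open U -> Ck_on k U f -> Ck_on k U g -> Ck_on k U h) ->
  smooth_at f x -> smooth_at g x -> smooth_at h x.
Proof.
move=> fgh [U [oU Ux] fU] [V [oV Vx] gV]; have oUV := openI oU oV.
exists (U `&` V) => // k; apply: fgh => //.
  by apply: Ck_on_sub (fU k) => y [].
by apply: Ck_on_sub (gV k) => y [].
Qed.

Lemma smooth_atD E F (f g : E -> F) x :
  smooth_at f x -> smooth_at g x -> smooth_at (fun x => f x + g x) x.
Proof. by apply: smooth_at2 => k U oU; exact: CkD. Qed.

Lemma smooth_atZ E F (f : E -> R) (g : E -> F) x :
  smooth_at f x -> smooth_at g x -> smooth_at (fun x => f x *: g x) x.
Proof. by apply: smooth_at2 => k U oU; exact: CkZ. Qed.

Lemma smooth_at_pair E F G (f : E -> F) (g : E -> G) x :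
  smooth_at f x -> smooth_at g x -> smooth_at (fun x => (f x, g x)) x.
Proof. by apply: smooth_at2 => k U oU; exact: Ck_pair. Qed.

Lemma smooth_at_comp E F G (f : E -> F) (g : F -> G) x : fin_dim F ->
  smooth_at f x -> smooth_at g (f x) -> smooth_at (g \o f) x.
Proof.
move=> fdF [U [oU Ux] fU] [V [oV Vx] gV].
have oW : open (U `&` f @^-1` V).
  rewrite openE => y [Uy Vy]; apply: filterI; first exact: open_nbhs_nbhs.
  have cf : {for y, continuous f} by apply: Ck_on_continuous (fU 0) Uy.
  by apply: cf; exact: open_nbhs_nbhs.
exists (U `&` f @^-1` V) => // k.
apply: (Ck_comp fdF oW oV) (gV k); first by move=> y [].
by apply: Ck_on_sub (fU k) => y [].
Qed.

Lemma smooth_atN E F (f : E -> F) x : smooth_at f x -> smooth_at (fun x => - f x) x.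
Proof.
move=> fx; rewrite (_ : (fun x => _) = (fun x => -1 *: f x)).
  by apply: smooth_atZ => //; exact: smooth_at_cst.
by apply: funext => y; rewrite scaleN1r.
Qed.

Lemma smooth_atB E F (f g : E -> F) x :
  smooth_at f x -> smooth_at g x -> smooth_at (fun x => f x - g x) x.
Proof. by move=> fx gx; apply: smooth_atD fx _; exact: smooth_atN. Qed.

End Germs.

(** * The inverse function theorem *)

Section InverseFunction.
Variable R : realType.
Implicit Types E F : normedModType R.

Lemma normr_coord n (v : 'rV[R]_n) i : `|v 0 i| <= `|v|.
Proof.
rewrite [leRHS]/Num.norm/= mx_normrE.
exact: (@le_bigmax _ R _ 0 (fun ij : 'I_1 * 'I_n => `|v ij.1 ij.2|) (0, i)).
Qed.

Lemma normr_rV_le n (v : 'rV[R]_n) K : 0 <= K -> (forall i, `|v 0 i| <= K) -> `|v| <= K.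
Proof.
move=> K0 vK; rewrite [leLHS]/Num.norm/= mx_normrE; apply: bigmax_le => // -[i j] _ /=.
by rewrite ord1.
Qed.

(** The one-variable theorem holds for each coordinate on the segment from x to v + x, and the
    norm of a row is the largest of its coordinates, so that the bound survives unchanged. *)
Lemma mean_value_rV E n (h : E -> 'rV[R]_n) (x v : E) K : 0 <= K ->
  (forall t : R, 0 <= t <= 1 ->
     differentiable h (t *: v + x) /\ `|'d h (t *: v + x) v| <= K) ->
  `|h (v + x) - h x| <= K.
Proof.
move=> K0 dh; apply: normr_rV_le => // i.
pose line (t : R) := t *: v + x.
pose phi := @row_coord R n i \o (h \o line).
have is_line t : is_diff t line (fun s => s *: v).
  have -> : line = (fun t => t *: v) + (fun=> x) by [].
  by apply: is_diff_eq; apply: funext => s; rewrite !fctE /= addr0.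
have c_coord : continuous (@row_coord R n i) by exact: coord_continuous.
have dphi (t : R) : 0 <= t <= 1 ->
    differentiable phi t /\ 'd phi t 1 = ('d h (line t) v) 0 i.
  move=> /dh[dht _].
  have dl : differentiable line t by exact: ex_diff.
  have dhl := differentiable_comp dl dht.
  have dc : differentiable (@row_coord R n i) (h (line t)) by exact: linear_differentiable.
  split; first exact: differentiable_comp.
  have := diff_comp dhl dc; rewrite diff_lin// => ->; rewrite /= diff_comp//= diff_val.
  by rewrite scale1r.
have [c c01] : exists2 c, c \in `[0, 1]%R & phi 1 - phi 0 = ('d h (line c) v) 0 i * (1 - 0).
  apply: (@MVT_segment R phi (fun c => ('d h (line c) v) 0 i)) => //.
    move=> t; rewrite in_itv/= => /andP[/ltW t0 /ltW t1].
    have [dp <-] := dphi t (introT andP (conj t0 t1)).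
    by rewrite -deriveE//; apply: derivableP; exact: diff_derivable.
  apply: derivable_within_continuous => t; rewrite in_itv/= => t01.
  by apply: diff_derivable; case: (dphi t t01).
rewrite subr0 mulr1 /phi/= /line/row_coord/= scale1r scale0r add0r !mxE => ->.
move: c01; rewrite in_itv/= => /dh[_]; apply: le_trans.
exact: normr_coord.
Qed.

Lemma diff_rV_sum n F (f : 'rV[R]_n -> F) x v :
  'd f x v = \sum_i v 0 i *: 'd f x (delta_mx 0 i).
Proof.
by rewrite {1}(row_sum_delta v) linear_sum; apply: eq_bigr => i _; rewrite linearZ.
Qed.

Lemma diff_fun_sub E F (f g : E -> F) x :
  differentiable f x -> differentiable g x ->
  differentiable (fun y => f y - g y) x /\
  forall v, 'd (fun y => f y - g y) x v = 'd f x v - 'd g x v.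
Proof.
move=> df dg; split; first exact: differentiableB df dg.
by move=> v; have /(congr1 (@^~ v)) := diffB df dg.
Qed.

Lemma diff_fun_id E (x v : E) : 'd (fun y : E => y) x v = v.
Proof.
have ci : continuous (@idfun E) by move=> z; exact: cvg_id.
by have /(congr1 (@^~ v)) := @diff_lin _ E E idfun x ci.
Qed.

Lemma diff_sub_id E (f : E -> E) x : differentiable f x ->
  differentiable (fun y => f y - y) x /\
  forall v, 'd (fun y => f y - y) x v = 'd f x v - v.
Proof.
move=> df; have di : differentiable (fun y : E => y) x := smooth_at_diff (smooth_at_id x).
have [dfi dfiE] := diff_fun_sub df di; split=> [|v]; first exact: dfi.
by rewrite dfiE diff_fun_id.
Qed.

Lemma Ck_det E k (U : set E) m (A : E -> 'M[R]_m) : open U ->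
  (forall i j, Ck_on k U (fun x => A x i j)) -> Ck_on k U (fun x => \det (A x)).
Proof.
move=> oU cA; rewrite /determinant; apply: Ck_sum => // s.
by apply: CkM => //; [exact: Ck_cst | exact: Ck_prod].
Qed.

(** Cramer's rule: the entries of the inverse are rational functions of those of the matrix. *)
Lemma Ck_invmx E k (U : set E) m (A : E -> 'M[R]_m) i j : open U ->
  (forall x, U x -> A x \in unitmx) ->
  (forall i j, Ck_on k U (fun x => A x i j)) -> Ck_on k U (fun x => invmx (A x) i j).
Proof.
move=> oU uA cA.
apply: (@Ck_on_ext _ _ _ _ _ (fun x => (\det (A x))^-1 * (\adj (A x)) i j)) => // [x Ux|].
  by rewrite /invmx (uA _ Ux) [RHS]mxE.
apply: CkM => //.
  apply: CkV => //; first by move=> x /uA; rewrite unitmxE unitfE.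
  exact: Ck_det.
apply: (@Ck_on_ext _ _ _ _ _ (fun x => (-1) ^+ (j + i) * \det (row' j (col' i (A x))))) => //.
  by move=> x _; rewrite mxE.
apply: CkM => //; first exact: Ck_cst.
by apply: Ck_det => // a b; rewrite (_ : (fun x => _) = (fun x => A x (lift j a) (lift i b)))//;
  apply: funext => x; rewrite !mxE.
Qed.

Section NearIdentity.
Variables (n : nat) (f : 'rV[R]_n -> 'rV[R]_n) (x0 : 'rV[R]_n) (r : R).
Hypothesis r0 : 0 < r.
Hypothesis fsm : forall x, `|x0 - x| < r -> smooth_at f x.
Hypothesis dfid : forall x, `|x0 - x| < r -> forall v, `|'d f x v - v| <= `|v| / 2.

(** The rest of this section rests on this: on the ball where its differential stays within 1/2
    of the identity, f is the identity plus a contraction. *)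
Lemma near_id_lipschitz x y : `|x0 - x| < r -> `|x0 - y| < r ->
  `|(f y - y) - (f x - x)| <= `|y - x| / 2.
Proof.
move=> xr yr; have := @mean_value_rV _ _ (fun z => f z - z) x (y - x) (`|y - x| / 2).
rewrite subrK; apply; first by rewrite divr_ge0.
move=> t /andP[t0 t1].
have br : `|x0 - (t *: (y - x) + x)| < r.
  have -> : x0 - (t *: (y - x) + x) = (1 - t) *: (x0 - x) + t *: (x0 - y).
    by apply/rowP => i; rewrite !mxE; ring.
  apply: le_lt_trans (ler_normD _ _) _; rewrite !normrZ !ger0_norm ?subr_ge0//.
  case: (eqVneq t 0) => [->|tn0]; first by rewrite subr0 mul1r mul0r addr0.
  have tp : 0 < t by rewrite lt_neqAle eq_sym tn0.
  have -> : r = (1 - t) * r + t * r by rewrite -mulrDl subrK mul1r.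
  apply: ler_ltD; first by rewrite ler_wpM2l ?subr_ge0// ltW.
  by rewrite ltr_pM2l.
have df := smooth_at_diff (fsm br).
have [dh dhE] := diff_sub_id df.
by split; [exact: dh | rewrite dhE; exact: dfid].
Qed.

Lemma near_id_expand x y : `|x0 - x| < r -> `|x0 - y| < r ->
  `|y - x| <= 2 * `|f y - f x|.
Proof.
move=> xr yr; have := near_id_lipschitz xr yr.
have -> : f y - y - (f x - x) = (f y - f x) - (y - x).
  by apply/rowP => i; rewrite !mxE; ring.
move=> h.
have : `|y - x| <= `|f y - f x| + `|y - x| / 2.
  have := ler_normB (f y - f x) ((f y - f x) - (y - x)); rewrite subKr.
  by move=> /le_trans; apply; rewrite lerD2l.
rewrite {1}[`|y - x|]splitr lerD2r ler_pdivrMr// mulrC.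
by rewrite mulrC.
Qed.

(** A solution of f x = y is a fixed point of x |-> x + (y - f x). This map contracts by 1/2, and
    it sends the closed ball of radius r / 2 into itself: it moves x0 by less than r / 4,
    and the images of x0 and of a point of this ball are within r / 4 of each other. *)
Lemma near_id_surj y : `|f x0 - y| < r / 4 -> exists2 x, `|x0 - x| < r / 2 & f x = y.
Proof.
move=> yr.
pose U := [set x | `|x0 - x| <= r / 2].
pose T x := x + (y - f x).
have r2 x : U x -> `|x0 - x| < r.
  by move=> Ux; apply: le_lt_trans Ux _; rewrite ltr_pdivrMr// ltr_pMr// ltr1n.
have x0r : `|x0 - x0| < r by rewrite subrr normr0.
have TU x : U x -> `|x0 - T x| < r / 2.
  move=> Ux; have -> : x0 - T x = (f x0 - y) + ((f x - x) - (f x0 - x0)).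
    by apply/rowP => i; rewrite /T !mxE; ring.
  apply: le_lt_trans (ler_normD _ _) _.
  have -> : r / 2 = r / 4 + r / 2 / 2 by field.
  apply: ltr_leD => //; apply: le_trans (near_id_lipschitz x0r (r2 _ Ux)) _.
  by rewrite ler_pM2r ?invr_gt0// distrC.
have TF : set_fun U U T by move=> x /TU/ltW.
pose TM := isFun.Build _ _ _ _ T TF.
pose TT : {fun U >-> U} := HB.pack T TM.
have ctr : is_contraction TT.
  exists (2^-1)%:nng; split; first by rewrite /= invf_lt1// ltr1n.
  move=> [x x'] [/= Ux Ux']; rewrite /T.
  have -> : x + (y - f x) - (x' + (y - f x')) = - ((f x - x) - (f x' - x')).
    by apply/rowP => i; rewrite !mxE; ring.
  rewrite normrN mulrC; exact: near_id_lipschitz (r2 _ Ux') (r2 _ Ux).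
have clU : closed U.
  have := @closed_closed_ball_ R _ x0 (r / 2).
  by rewrite /closed_ball_.
have U0 : U !=set0 by exists x0; rewrite /U/= subrr normr0 divr_ge0// ltW.
have [p Up pT] := banach_fixed_point ctr clU U0.
exists p; first by rewrite pT; exact: TU.
by apply/eqP; rewrite eq_sym -subr_eq0; apply/eqP/(addrI p); rewrite addr0 [RHS]pT.
Qed.

Definition local_inverse y :=
  xget x0 [set x | `|x0 - x| < r / 2 /\ f x = y].
Let g := local_inverse.
Let W := [set y | `|f x0 - y| < r / 4].

Lemma half_radius x : `|x0 - x| < r / 2 -> `|x0 - x| < r.
Proof. by move=> h; apply: lt_trans h _; rewrite ltr_pdivrMr// ltr_pMr// ltr1n. Qed.

Lemma local_inverseP y : W y -> `|x0 - g y| < r / 2 /\ f (g y) = y.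
Proof.
move=> /near_id_surj[x xr fx]; rewrite /g /local_inverse.
by case: xgetP => [z -> //|/(_ x)[]].
Qed.

Lemma local_inverseK x : `|x0 - x| < r / 2 -> W (f x) -> g (f x) = x.
Proof.
move=> xr /local_inverseP[gr fg].
have := near_id_expand (half_radius xr) (half_radius gr).
by rewrite fg subrr normr0 mulr0 normr_le0 subr_eq0 => /eqP.
Qed.

Lemma open_dist (z : 'rV[R]_n) e : open [set y | `|z - y| < e].
Proof. by have := @ball_open R _ z e; rewrite -ball_normE. Qed.

Lemma local_inverse_lipschitz y z : W y -> W z -> `|g z - g y| <= 2 * `|z - y|.
Proof.
move=> /local_inverseP[gy fy] /local_inverseP[gz fz].
by have := near_id_expand (half_radius gy) (half_radius gz); rewrite fy fz.
Qed.

Definition jac x : 'M[R]_n := lin1_mx ('d f x).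

Lemma mul_jac x v : v *m jac x = 'd f x v.
Proof. by rewrite mul_rV_lin1. Qed.

Lemma jac_unit x : `|x0 - x| < r -> jac x \in unitmx.
Proof.
move=> xr; rewrite -row_free_unit -kermx_eq0; apply/rowV0P => v /sub_kermxP.
rewrite mul_jac => dv0; have := dfid xr v.
rewrite dv0 sub0r normrN {1}[`|v|]splitr gerDl.
rewrite pmulr_lle0// normr_le0.
by move=> /eqP.
Qed.

(** Expanding f at g y gives z - y = J (g z - g y) + o (g z - g y) with J invertible. The error
    is o (z - y) because g is Lipschitz. *)
Lemma local_inverse_diff y : W y -> differentiable g y /\
  forall v, 'd g y v = v *m invmx (jac (g y)).
Proof.
move=> Wy; have [gr fg] := local_inverseP Wy.
have gr' := half_radius gr.
have Ju := jac_unit gr'.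
have df := smooth_at_diff (fsm gr').
pose L := mulmxr (invmx (jac (g y))) : {linear 'rV[R]_n -> 'rV[R]_n}.
have cL : continuous L by apply: fin_dim_continuous; exact: fin_dim_rV.
suff gL : g \o shift y = cst (g y) + L +o_ 0 id.
  have dE := diff_unique cL gL.
  by split; [apply/diff_locallyP; rewrite dE|move=> v; rewrite dE].
apply/eqaddoP => e e0.
have [C C0 LC] := linear_lipschitz cL.
have e'0 : 0 < e / (C * 2) by rewrite divr_gt0// mulr_gt0.
have /diff_locally/eqaddoP/(_ _ e'0) := df.
rewrite -nbhs_nearE => /nbhs_normP[d /= d0 dP].
have nW : \forall h \near (0 : 'rV[R]_n), W (h + y).
  have : \forall z \near y, W z by apply: open_nbhs_nbhs; split=> //; exact: open_dist.
  by rewrite (near_shift 0 y) subr0.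
have nd : \forall h \near (0 : 'rV[R]_n), `|h| < d / 2 by apply: nbhs0_lt; rewrite divr_gt0.
apply: filterS2 nW nd => h Wh hd.
pose D := g (h + y) - g y.
have D2 : `|D| <= 2 * `|h|.
  by have := local_inverse_lipschitz Wy Wh; rewrite addrK.
have : `|0 - D| < d.
  by rewrite sub0r normrN; apply: le_lt_trans D2 _; rewrite mulrC -ltr_pdivlMr.
move=> /dP /=; rewrite !fctE /= subrK.
have [_ ->] := local_inverseP Wh; rewrite fg => Dle.
have -> : g (h + y) - (g y + L h) = - L (h + y - (y + 'd f (g y) D)).
  have -> : h + y - (y + 'd f (g y) D) = h - 'd f (g y) D.
    by apply/rowP => i; rewrite !mxE; ring.
  rewrite linearB/= -mul_jac mulmxK// opprB /D -[in RHS]addrA.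
  by rewrite opprD.
rewrite normrN; apply: le_trans (LC _) _.
apply: (@le_trans _ _ (C * (e / (C * 2) * `|D|))); first by rewrite ler_pM2l.
apply: (@le_trans _ _ (C * (e / (C * 2) * (2 * `|h|)))).
  by rewrite ler_pM2l// ler_pM2l.
rewrite le_eqVlt; apply/orP; left; apply/eqP.
by field; rewrite gt_eqF.
Qed.

(** The differential of g at y is the inverse matrix of the differential of f at g y, hence it
    is C^k as soon as g is: regularity is gained one order at a time. *)
Lemma local_inverse_smooth : smooth_on W g.
Proof.
have oW : open W by exact: open_dist.
have oU : open [set x | `|x0 - x| < r] by exact: open_dist.
have fU : smooth_on [set x | `|x0 - x| < r] f by apply/smooth_on_germ.
elim=> [|k IH].
  move=> y /[!inE] /local_inverse_diff[dg _].
  exact: differentiable_continuous.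
split=> [y /local_inverse_diff[]//|v].
have gU y : W y -> `|x0 - g y| < r by move=> /local_inverseP[/half_radius].
apply: (@Ck_on_ext _ _ _ _ _ (fun y => v *m invmx (jac (g y)))) => // [y /local_inverse_diff[_ ->]//|].
apply: (@Ck_on_ext _ _ _ _ _ (fun y =>
    \sum_j (\sum_i v 0 i *: invmx (jac (g y)) i j) *: delta_mx 0 j)) => // [y _|].
  by rewrite [RHS]row_sum_delta; apply: eq_bigr => j _; rewrite mxE.
apply: Ck_sum => // j; apply: CkZ => //; last exact: Ck_cst.
apply: Ck_sum => // i; apply: CkZ => //; first exact: Ck_cst.
apply: Ck_invmx => // [y /gU|a b]; first exact: jac_unit.
have /Ck_onS[_ /(_ (delta_mx 0 a)) dfk] := fU k.+1.
apply: (@Ck_on_ext _ _ _ _ _ (row_coord b \o ((fun x => 'd f x (delta_mx 0 a)) \o g))) => //.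
  by move=> y _; rewrite /= /row_coord /jac mxE.
have cb : continuous (@row_coord R n b) by exact: coord_continuous.
have dk := Ck_comp (fin_dim_rV R n) oW oU gU IH dfk.
exact: (Ck_linear_comp cb oW dk).
Qed.

End NearIdentity.

Lemma smooth_at_partial n F (f : 'rV[R]_n -> F) x v :
  smooth_at f x -> {for x, continuous (fun y => 'd f y v)}.
Proof.
move=> [U [oU Ux] fU]; have /Ck_onS[_ /(_ v) h] := fU 1.
exact: Ck_on_continuous h Ux.
Qed.

Lemma continuous_near_dist (T : topologicalType) E (g : T -> E) x a (e : R) :
  {for x, continuous g} -> g x = a -> 0 < e -> \forall y \near x, `|g y - a| < e.
Proof.
move=> cg <- e0; have /cvgr_dist_lt/(_ e e0) := cg.
by apply: filterS => y; rewrite distrC.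
Qed.

(** A map with invertible differential reduces to this case by a linear change of coordinates;
    submersions reduce to it as well, see [submersion_straighten]. *)
Theorem inverse_function n (f : 'rV[R]_n -> 'rV[R]_n) x0 :
  smooth_at f x0 -> (forall v, 'd f x0 v = v) ->
  exists U W g, [/\ open_nbhs x0 U, open_nbhs (f x0) W,
    forall x, U x -> [/\ W (f x), g (f x) = x & smooth_at f x] &
    forall y, W y -> [/\ U (g y), f (g y) = y & smooth_at g y]].
Proof.
move=> fx0 df0.
pose c : R := (2 * n.+1%:R)^-1.
have c0 : 0 < c by rewrite invr_gt0 mulr_gt0.
have smx := smooth_at_near fx0.
have dnear : \forall x \near x0, forall i : 'I_n, `|'d f x (delta_mx 0 i) - delta_mx 0 i| < c.
  apply: (@filter_forall _ 'I_n
    (fun i x => `|'d f x (delta_mx 0 i) - delta_mx 0 i| < c) _ (nbhs_filter x0)) => i.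
  exact: (continuous_near_dist (@smooth_at_partial _ _ _ _ (delta_mx 0 i) fx0) (df0 _) c0).
have : \forall x \near x0, smooth_at f x /\
    forall i : 'I_n, `|'d f x (delta_mx 0 i) - delta_mx 0 i| < c.
  by apply: filterS2 smx dnear.
rewrite -nbhs_nearE => /nbhs_normP[r /= r0 rP].
have fsm x : `|x0 - x| < r -> smooth_at f x by move=> /rP[].
have dfid x : `|x0 - x| < r -> forall v, `|'d f x v - v| <= `|v| / 2.
  move=> /rP[_ dP] v.
  rewrite diff_rV_sum {2}(row_sum_delta v) -sumrB.
  apply: (@le_trans _ _ (\sum_(i < n) `|v| * c)).
    apply: le_trans (ler_norm_sum _ _ _) _; apply: ler_sum => i _.
    by rewrite -scalerBr normrZ ler_pM// ?normr_coord// ltW.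
  rewrite sumr_const card_ord -mulrnAr; apply: ler_wpM2l => //.
  rewrite -[c *+ n]mulr_natr.
  by rewrite /c mulrC ler_pdivrMr ?mulr_gt0// mulKf// ler_nat.
pose W := [set y | `|f x0 - y| < r / 4].
pose U := [set x | `|x0 - x| < r / 2 /\ W (f x)].
have half x : `|x0 - x| < r / 2 -> `|x0 - x| < r by exact: half_radius.
have oW : open W by exact: open_dist.
have Wf0 : W (f x0) by rewrite /W/= subrr normr0 divr_gt0.
have oU : open U.
  rewrite openE => x [xr Wx]; apply: filterI.
    by apply: open_nbhs_nbhs; split=> //; exact: open_dist.
  by apply: (smooth_at_cont (fsm _ (half _ xr))); exact: open_nbhs_nbhs.
exists U, W, (local_inverse f x0 r); split=> //.
- by split=> //; split=> //; rewrite subrr normr0 divr_gt0.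
- move=> x [xr Wx]; split=> //; first exact: local_inverseK.
  exact/fsm/half.
- move=> y Wy; have [gr fg] := local_inverseP r0 fsm dfid Wy.
  split=> //; first by split=> //; rewrite fg.
  by exists W => //; exact: local_inverse_smooth.
Qed.

End InverseFunction.

(** * Charts, smooth maps and tangent maps *)

Section Charts.
Variable R : realType.
Implicit Types M N P L : manifold R.

(** The map h is only required to agree with g o f near x: expressions of maps in charts compose
    in this weak sense only, because a chart covers only a part of the manifold. *)
Lemma smooth_chain (E F G : normedModType R) (f : E -> F) (g : F -> G) (h : E -> G) x y :
  fin_dim F -> f x = y -> smooth_at f x -> smooth_at g y ->
  (\forall z \near x, h z = g (f z)) ->
  smooth_at h x /\ forall v w, 'd f x v = w -> 'd h x v = 'd g y w.
Proof.
move=> fdF <- fs gs hgf.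
have gfs := smooth_at_comp fdF fs gs.
have near_eq : \forall z \near x, (g \o f) z = h z.
  by apply: filterS hgf => z ->.
split; first exact: smooth_at_ext near_eq gfs.
have [_ dh] := near_eq_is_diff near_eq (smooth_at_diff gfs).
have dgf := diff_comp (smooth_at_diff fs) (smooth_at_diff gs).
by move=> v w <-; exact: etrans (congr1 (@^~ v) dh) (congr1 (@^~ v) dgf).
Qed.

Lemma smooth_chain_comp (E F G : normedModType R) (f : E -> F) (g : F -> G) x y :
  fin_dim F -> f x = y -> smooth_at f x -> smooth_at g y ->
  smooth_at (g \o f) x /\ forall v w, 'd f x v = w -> 'd (g \o f) x v = 'd g y w.
Proof.
move=> fdF fxy fs gs; apply: (smooth_chain fdF fxy fs gs).
exact: nearW.
Qed.

Lemma is_chart_open_image (T : topologicalType) n (c : chart R T n) (A : set T) :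
  is_chart c -> open A -> open (coord c @` (dom c `&` A)).
Proof.
move=> [odc oim _ cpar coK] oA; rewrite openE => _ [p [dp Ap] <-].
have cp : {for coord c p, continuous (param c)} by apply: cpar; rewrite inE; exists p.
have nA : \forall z \near coord c p, A (param c z).
  by apply: cp; rewrite coK//; exact: open_nbhs_nbhs.
have nI : \forall z \near coord c p, chart_image c z.
  by apply: open_nbhs_nbhs; split=> //; exists p.
apply: filterS2 nI nA => _ [q dq <-]; rewrite coK// => Aq.
by exists q.
Qed.

Section OneChart.
Variables (M : manifold R) (c : chart R M (mdim M)).
Hypothesis ac : atlas c.

Lemma chart_open : open (dom c).
Proof. by have [] := atlas_chart ac. Qed.

Lemma coordK p : dom c p -> param c (coord c p) = p.
Proof. by have [_ _ _ _] := atlas_chart ac; exact. Qed.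

Lemma chart_imageP z : chart_image c z -> dom c (param c z) /\ coord c (param c z) = z.
Proof. by move=> [p dp <-]; rewrite coordK. Qed.

Lemma coord_cont p : dom c p -> {for p, continuous (coord c)}.
Proof. by move=> dp; have [_ _ h _ _] := atlas_chart ac; apply: h; rewrite inE. Qed.

Lemma param_cont p : dom c p -> {for (coord c p), continuous (param c)}.
Proof.
move=> dp; have [_ _ _ h _] := atlas_chart ac; apply: h; rewrite inE.
by exists p.
Qed.

Lemma near_dom p : dom c p -> \forall q \near p, dom c q.
Proof. by move=> dp; apply: open_nbhs_nbhs; split=> //; exact: chart_open. Qed.

Lemma near_chart_image p : dom c p -> \forall z \near coord c p, chart_image c z.
Proof.
move=> dp; apply: open_nbhs_nbhs; split; last by exists p.
by have [] := atlas_chart ac.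
Qed.

Lemma near_coord p (P : set 'rV[R]_(mdim M)) : dom c p ->
  (\forall z \near coord c p, P z) -> \forall q \near p, P (coord c q).
Proof. by move=> dp; apply: (coord_cont dp). Qed.

Lemma near_param p (P : set M) : dom c p ->
  (\forall q \near p, P q) -> \forall z \near coord c p, P (param c z).
Proof.
move=> dp nP; apply: (param_cont dp).
by rewrite coordK.
Qed.

Lemma open_chart_image (A : set M) : open A -> open (coord c @` (dom c `&` A)).
Proof. exact/is_chart_open_image/atlas_chart. Qed.

End OneChart.

Lemma transition_smooth M (c d : chart R M (mdim M)) p : atlas c -> atlas d ->
  dom c p -> dom d p -> smooth_at (coord d \o param c) (coord c p).
Proof.
move=> ac ad dc dd; exists (coord c @` (dom c `&` dom d)); last exact: atlas_smooth.
by split; [apply: open_chart_image => //; exact: chart_open|exists p].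
Qed.

(** Changing charts composes with transition maps on both sides. *)
Lemma change_charts M N (f : M -> N) p (c c' : chart R M (mdim M))
  (d d' : chart R N (mdim N)) :
  atlas c -> atlas c' -> atlas d -> atlas d' ->
  dom c p -> dom c' p -> dom d (f p) -> dom d' (f p) ->
  {for p, continuous f} ->
  smooth_at (coord d \o f \o param c) (coord c p) ->
  smooth_at (coord d' \o f \o param c') (coord c' p) /\
  forall v, 'd (coord d' \o f \o param c') (coord c' p) v =
    'd (coord d' \o param d) (coord d (f p))
      ('d (coord d \o f \o param c) (coord c p) ('d (coord c \o param c') (coord c' p) v)).
Proof.
move=> ac ac' ad ad' cp c'p dp d'p cf fs.
have fd k := fin_dim_rV R k.
have ts := transition_smooth ac' ac c'p cp.
have td := transition_smooth ad ad' dp d'p.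
have e1 : (coord c \o param c') (coord c' p) = coord c p by rewrite /= coordK.
have [s12 d12] := smooth_chain_comp (fd _) e1 ts fs.
have e2 : ((coord d \o f \o param c) \o (coord c \o param c')) (coord c' p) = coord d (f p).
  by rewrite /= !coordK.
have n1 : \forall q \near p, dom c q /\ dom d (f q).
  apply: filterI; first exact: near_dom.
  by apply: cf; exact: near_dom.
have near_eq : \forall z \near coord c' p, (coord d' \o f \o param c') z =
    (coord d' \o param d) (((coord d \o f \o param c) \o (coord c \o param c')) z).
  apply: filterS (near_param ac' c'p n1) => z [cz dz].
  by rewrite /= (coordK ac cz) (coordK ad dz).
have [s123 d123] := smooth_chain (fd _) e2 s12 td near_eq.
split; first exact: s123.
move=> v; exact: (d123 v _ (d12 v _ erefl)).
Qed.

(** Read in the charts that represent tangent vectors, so that the differential of this local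
    expression is the tangent map. *)
Definition msmooth_at M N (f : M -> N) p :=
  {for p, continuous f} /\
  smooth_at (loc (f p) \o f \o param (chart_at p)) (loc p p).

Lemma msmooth_charts M N (f : M -> N) p (c : chart R M (mdim M)) (d : chart R N (mdim N)) :
  msmooth_at f p -> atlas c -> atlas d -> dom c p -> dom d (f p) ->
  smooth_at (coord d \o f \o param c) (coord c p).
Proof.
move=> [cf fs] ac ad cp dp.
exact: (change_charts (chart_at_atlas p) ac (chart_at_atlas (f p)) ad (chart_at_dom p) cp
  (chart_at_dom (f p)) dp cf fs).1.
Qed.

Lemma msmooth_of_charts M N (f : M -> N) p (c : chart R M (mdim M)) (d : chart R N (mdim N)) :
  atlas c -> atlas d -> dom c p -> dom d (f p) -> {for p, continuous f} ->
  smooth_at (coord d \o f \o param c) (coord c p) -> msmooth_at f p.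
Proof.
move=> ac ad cp dp cf fs; split=> //.
exact: (change_charts ac (chart_at_atlas p) ad (chart_at_atlas (f p)) cp (chart_at_dom p)
  dp (chart_at_dom (f p)) cf fs).1.
Qed.

Lemma smoothP M N (f : M -> N) : smooth f <-> forall p, msmooth_at f p.
Proof.
split=> [[cf fs] p|fs].
  split; first exact: cf.
  have ac := chart_at_atlas p; have ad := chart_at_atlas (f p).
  exists (coord (chart_at p) @` (dom (chart_at p) `&` f @^-1` dom (chart_at (f p)))); last exact: fs.
  split; last by exists p => //; split; exact: chart_at_dom.
  by apply: open_chart_image => //; apply: open_comp => [x _|]; [exact: cf|exact: chart_open].
have cf : continuous f by move=> p; case: (fs p).
split=> // c d ac ad; apply/smooth_on_germ.
  by apply: open_chart_image => //; apply: open_comp => [x _|]; [exact: cf|exact: chart_open].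
by move=> _ [p [cp dp] <-]; exact: msmooth_charts.
Qed.

Lemma smooth_msmooth M N (f : M -> N) p : smooth f -> msmooth_at f p.
Proof. by move=> /smoothP. Qed.

Lemma msmooth_comp L M N (f : L -> M) (g : M -> N) p :
  msmooth_at f p -> msmooth_at g (f p) -> msmooth_at (g \o f) p /\
  forall u, tmap (g \o f) p u = tmap g (f p) (tmap f p u).
Proof.
move=> [cf fs] [cg gs].
have e1 : (loc (f p) \o f \o param (chart_at p)) (loc p p) = loc (f p) (f p).
  by rewrite /= (coordK (chart_at_atlas p))//; exact: chart_at_dom.
have n1 : \forall q \near p, dom (chart_at (f p)) (f q).
  by apply: cf; apply: near_dom; [exact: chart_at_atlas|exact: chart_at_dom].
have near_eq : \forall z \near loc p p, (loc (g (f p)) \o (g \o f) \o param (chart_at p)) z =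
    (loc (g (f p)) \o g \o param (chart_at (f p))) ((loc (f p) \o f \o param (chart_at p)) z).
  apply: filterS (near_param (chart_at_atlas p) (chart_at_dom p) n1) => z dz.
  by rewrite /= (coordK (chart_at_atlas _) dz).
have [s12 d12] := smooth_chain (fin_dim_rV _ _) e1 fs gs near_eq.
split; last by move=> u; exact: (d12 u _ erefl).
by split; [exact: continuous_comp | exact: s12].
Qed.

Lemma smooth_comp L M N (f : L -> M) (g : M -> N) : smooth f -> smooth g -> smooth (g \o f).
Proof.
move=> /smoothP fs /smoothP gs; apply/smoothP => p.
by have [] := msmooth_comp (fs p) (gs (f p)).
Qed.

Lemma tmap_comp L M N (f : L -> M) (g : M -> N) p u : smooth f -> smooth g ->
  tmap (g \o f) p u = tmap g (f p) (tmap f p u).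
Proof.
move=> /smoothP fs /smoothP gs.
by have [_ d] := msmooth_comp (fs p) (gs (f p)); exact: d.
Qed.

Lemma smooth_cst M N (q : N) : smooth (fun _ : M => q).
Proof.
apply/smoothP => p; split; first exact: cst_continuous.
exact: smooth_at_cst.
Qed.

Lemma tmap_cst M N (q : N) p u : tmap (fun _ : M => q) p u = 0.
Proof.
exact: (congr1 (@^~ u) (@diff_cst R _ _ (loc q q) (loc p p))).
Qed.

Lemma loc_param M (q : M) z : chart_image (chart_at q) z -> loc q (param (chart_at q) z) = z.
Proof. by move=> /(chart_imageP (chart_at_atlas q))[]. Qed.

Lemma smooth_id M : smooth (fun p : M => p).
Proof.
apply/smoothP => p; split; first exact: cvg_id.
apply: smooth_at_ext (smooth_at_id _); apply: filterS (near_chart_image (chart_at_atlas p) (chart_at_dom p)).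
by move=> z /loc_param; exact.
Qed.

Lemma tmap_id M (p : M) u : tmap (fun p : M => p) p u = u.
Proof.
have near_eq : \forall z \near loc p p, z = (loc p \o (fun p => p) \o param (chart_at p)) z.
  apply: filterS (near_chart_image (chart_at_atlas p) (chart_at_dom p)).
  by move=> z /loc_param /= ->.
have did : differentiable (fun z : Tsp M => z) (loc p p) by exact: smooth_at_diff (@smooth_at_id R 'rV[R]_(mdim M) _).
have [_ d_eq] := @near_eq_is_diff _ _ _ (fun z => z) _ _ near_eq did.
exact: etrans (congr1 (@^~ u) d_eq) (@diff_fun_id R 'rV[R]_(mdim M) _ u).
Qed.

Lemma tmap0 M N (f : M -> N) p : tmap f p 0 = 0.
Proof. by rewrite /tmap linear0. Qed.

End Charts.

Section TwoArguments.
Variable R : realType.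
Implicit Types M N P L : manifold R.

Lemma near_loc M (p : M) (P : set (Tsp M)) :
  (\forall z \near loc p p, P z) -> \forall q \near p, P (loc p q).
Proof. exact: (near_coord (chart_at_atlas p) (chart_at_dom p)). Qed.

Lemma near_chart M (p : M) (P : set M) :
  (\forall q \near p, P q) -> \forall z \near loc p p, P (param (chart_at p) z).
Proof. exact: (near_param (chart_at_atlas p) (chart_at_dom p)). Qed.

Lemma locK M (p q : M) : dom (chart_at p) q -> param (chart_at p) (loc p q) = q.
Proof. exact: (coordK (chart_at_atlas p)). Qed.

(** The extension F agrees with f on A only. This suffices for the chain rule, because
    z |-> (a z, b z) stays in A. *)
Lemma msmooth_pairs L M N P (A : set (M * N)) (f : M -> N -> P) (a : L -> M) (b : L -> N)
  (F : Tsp M * Tsp N -> Tsp P) y :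
  msmooth_at a y -> msmooth_at b y -> (\forall z \near y, A (a z, b z)) ->
  local_extension A f (a y) (b y) F ->
  msmooth_at (fun z => f (a z) (b z)) y /\
  forall u, tmap (fun z => f (a z) (b z)) y u =
    'd F (loc (a y) (a y), loc (b y) (b y)) (tmap a y u, tmap b y u).
Proof.
move=> [ca as_] [cb bs] nA [[U [oU Uab] Fs] nF].
have Fsm : smooth_at F (loc (a y) (a y), loc (b y) (b y)) by exists U.
have cab : {for y, continuous (fun z => (a z, b z))} by exact: cvg_pair.
have nf : \forall z \near y, dom (chart_at (f (a y) (b y))) (f (a z) (b z)) /\
    loc (f (a y) (b y)) (f (a z) (b z)) = F (loc (a y) (a z), loc (b y) (b z)).
  have nFab : \forall z \near y, A (a z, b z) ->
      dom (chart_at (f (a y) (b y))) (f (a z) (b z)) /\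
      loc (f (a y) (b y)) (f (a z) (b z)) = F (loc (a y) (a z), loc (b y) (b z)).
    exact: (cab _ nF).
  by apply: filterS2 nA nFab => z Az; exact.
have [dfy fy] := nbhs_singleton nf.
pose h1 := fun z => ((loc (a y) \o a \o param (chart_at y)) z,
                     (loc (b y) \o b \o param (chart_at y)) z).
have h1s : smooth_at h1 (loc y y) by exact: smooth_at_pair.
have e1 : h1 (loc y y) = (loc (a y) (a y), loc (b y) (b y)).
  by rewrite /h1 /= locK//; exact: chart_at_dom.
have near_eq : \forall z \near loc y y,
    (loc (f (a y) (b y)) \o (fun z => f (a z) (b z)) \o param (chart_at y)) z = F (h1 z).
  by apply: filterS (near_chart nf) => z [].
have fd := fin_dim_prod (fin_dim_rV R (mdim M)) (fin_dim_rV R (mdim N)).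
have [s12 d12] := smooth_chain fd e1 h1s Fsm near_eq.
split; last first.
  move=> u; apply: (d12 u).
  exact: (congr1 (@^~ u) (diff_pair (smooth_at_diff as_) (smooth_at_diff bs))).
split; last exact: s12.
have cla : {for y, continuous (loc (a y) \o a)}.
  by apply: continuous_comp => //; apply: coord_cont; [exact: chart_at_atlas|exact: chart_at_dom].
have clb : {for y, continuous (loc (b y) \o b)}.
  by apply: continuous_comp => //; apply: coord_cont; [exact: chart_at_atlas|exact: chart_at_dom].
have cF : {for (loc (a y) (a y), loc (b y) (b y)), continuous F} by exact: smooth_at_cont.
have clF : {for y, continuous (fun z => F (loc (a y) (a z), loc (b y) (b z)))}.
  apply: (@continuous_comp _ _ _ (fun z => (loc (a y) (a z), loc (b y) (b z))) F); last exact: cF.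
  exact: (cvg_pair cla clb).
have cpF : {for y, continuous (param (chart_at (f (a y) (b y))) \o
    (fun z => F (loc (a y) (a z), loc (b y) (b z))))}.
  apply: (continuous_comp clF); rewrite /= -fy.
  by apply: param_cont; [exact: chart_at_atlas|exact: chart_at_dom].
apply: near_eq_continuous cpF.
by apply: filterS nf => z [dz ez]; rewrite /= -ez locK.
Qed.

Lemma smooth_pairs L M N P (A : set (M * N)) (f : M -> N -> P) (a : L -> M) (b : L -> N) :
  smooth_on_pairs A f -> smooth a -> smooth b -> (forall z, A (a z, b z)) ->
  smooth (fun z => f (a z) (b z)).
Proof.
move=> fA /smoothP sa /smoothP sb Aab; apply/smoothP => y.
have [F Fext] := fA _ _ (Aab y).
by have [] := msmooth_pairs (sa y) (sb y) (nearW _ Aab) Fext.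
Qed.

Lemma tmap_pairs L M N P (A : set (M * N)) (f : M -> N -> P) (a : L -> M) (b : L -> N)
  (F : Tsp M * Tsp N -> Tsp P) y u :
  smooth a -> smooth b -> (forall z, A (a z, b z)) ->
  local_extension A f (a y) (b y) F ->
  tmap (fun z => f (a z) (b z)) y u =
    'd F (loc (a y) (a y), loc (b y) (b y)) (tmap a y u, tmap b y u).
Proof.
move=> /smoothP sa /smoothP sb Aab Fext.
by have [_ d] := msmooth_pairs (sa y) (sb y) (nearW _ Aab) Fext; exact: d.
Qed.

End TwoArguments.

(** * Straightening a submersion *)

Section Straightening.
Variable R : realType.
Implicit Types E F G : normedModType R.

Lemma diff_fun_add E F (f g : E -> F) x :
  differentiable f x -> differentiable g x ->
  differentiable (fun y => f y + g y) x /\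
  forall v, 'd (fun y => f y + g y) x v = 'd f x v + 'd g x v.
Proof.
move=> df dg; split; first exact: differentiableD df dg.
by move=> v; have /(congr1 (@^~ v)) := diffD df dg.
Qed.

Lemma diff_linear E F (l : {linear E -> F}) x v : fin_dim E -> 'd l x v = l v.
Proof.
move=> fd.
by have /(congr1 (@^~ v)) := @diff_lin _ _ _ l x (fin_dim_continuous fd).
Qed.

Lemma surjective_row_full n m (f : {linear 'rV[R]_n -> 'rV[R]_m}) :
  (forall w, exists u, f u = w) -> row_full (lin1_mx f).
Proof.
move=> surj; apply/row_fullP.
have [g gP] := choice surj.
exists (\matrix_i g (delta_mx 0 i)); apply/row_matrixP => i.
by rewrite row_mul rowK mul_rV_lin1 /= gP rowE mulmx1.
Qed.

(** Let D be the differential of f at x0 and B a right inverse of D. The map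
      Phi x = (x - x0) + B (f x - f x0 - D (x - x0))
    has the identity as differential at x0, so it is a change of coordinates, and
    D (Phi x) = f x - f x0: in the coordinates Phi, the map f is affine. *)
Lemma submersion_straighten n m (f : 'rV[R]_n -> 'rV[R]_m) x0 (A : set 'rV[R]_n) :
  smooth_at f x0 -> (forall w, exists u, 'd f x0 u = w) -> (\forall x \near x0, A x) ->
  exists U W (Phi Psi : 'rV[R]_n -> 'rV[R]_n),
  [/\ open_nbhs x0 U /\ open_nbhs 0 W, U `<=` A, Phi x0 = 0 /\ (forall v, 'd Psi 0 v = v),
    forall x, U x -> [/\ W (Phi x), Psi (Phi x) = x, smooth_at Phi x &
      f x = f x0 + 'd f x0 (Phi x)] &
    forall y, W y -> [/\ U (Psi y), Phi (Psi y) = y & smooth_at Psi y]].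
Proof.
move=> fs surj nA.
have /row_fullP[B BA] := surjective_row_full surj.
have [D [DE BD]] : exists D : {linear 'rV[R]_n -> 'rV[R]_m},
    (forall v, 'd f x0 v = D v) /\ B *m lin1_mx D = 1%:M by exists ('d f x0).
pose Bl : {linear 'rV[R]_m -> 'rV[R]_n} := mulmxr B.
have DB w : D (Bl w) = w by rewrite /Bl /= -mul_rV_lin1 -mulmxA BD mulmx1.
have fdn := fin_dim_rV R n; have fdm := fin_dim_rV R m.
(* Phi is the sum of the identity and of B o q, up to a constant, and q is stationary at x0. *)
pose q x := f x - D x.
have Ds : smooth_at D x0 by exact: smooth_at_lin.
have qs : smooth_at q x0 by exact: smooth_atB.
have dq v : 'd q x0 v = 0.
  have [_ dq] := diff_fun_sub (smooth_at_diff fs) (smooth_at_diff Ds).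
  exact: (etrans (dq v) (etrans (congr2 (fun a b => a - b) (DE v) (diff_linear D x0 v fdn)) (subrr _))).
have [Bqs dBq] := smooth_chain_comp fdm (erefl (q x0)) qs (@smooth_at_lin _ _ _ Bl (q x0) fdm).
pose Phi x := (x + (Bl \o q) x) - (x0 + Bl (q x0)).
have ids : smooth_at (fun x : 'rV[R]_n => x) x0 := smooth_at_id x0.
have sPhi : smooth_at Phi x0.
  by apply: smooth_atB; [exact: smooth_atD | exact: smooth_at_cst].
have dPhi v : 'd Phi x0 v = v.
  have [d1 e1] := diff_fun_add (smooth_at_diff ids) (smooth_at_diff Bqs).
  have [d2 e2] := diff_fun_sub d1 (smooth_at_diff (smooth_at_cst (x0 + Bl (q x0)) x0)).
  have e3 := dBq v _ (dq v); rewrite linear0 in e3.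
  have e4 := congr1 (@^~ v) (@diff_cst R _ _ (x0 + Bl (q x0)) x0).
  have e5 : 'd (fun y => y + (Bl \o q) y) x0 v = v.
    by apply: (etrans (e1 v)); apply: (etrans (congr2 +%R (diff_fun_id x0 v) e3)); rewrite addr0.
  by apply: (etrans (e2 v)); apply: (etrans (congr2 (fun a b => a - b) e5 e4)); rewrite subr0.
have Phi0 : Phi x0 = 0 by rewrite /Phi /= subrr.
have DPhi x : f x = f x0 + D (Phi x).
  by rewrite /Phi /= linearB [D (x + _)]linearD [D (x0 + _)]linearD !DB /q !subrKC.
have [U [W [Psi [[oU Ux0] [oW Wy0] UP WP]]]] := inverse_function sPhi dPhi.
rewrite Phi0 in Wy0.
have [_ PsiPhi0 _] := UP _ Ux0; rewrite Phi0 in PsiPhi0.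
have cPsi y : W y -> {for y, continuous Psi} by move=> /WP[_ _ /smooth_at_cont].
have nintA : \forall x \near x0, A° x by exact: nbhs_interior.
exists (U `&` A°), (W `&` Psi @^-1` A°), Phi, Psi; split.
- split; split.
  + exact: openI oU (open_interior A).
  + by split=> //; exact: nbhs_singleton nintA.
  + rewrite openE => y [Wy Ay]; apply: filterI; first exact: open_nbhs_nbhs.
    by apply: cPsi => //; apply: open_nbhs_nbhs; split=> //; exact: open_interior.
  + by split=> //=; rewrite PsiPhi0; exact: nbhs_singleton nintA.
- by move=> x [_ /interior_subset].
- split; first exact: Phi0.
  move=> v; have [_ _ sPsi] := WP _ Wy0.
  have sPhi' : smooth_at Phi (Psi 0) by rewrite PsiPhi0.
  have near_eq : \forall y \near (0 : 'rV[R]_n), y = Phi (Psi y).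
    have : \forall y \near (0 : 'rV[R]_n), W y by exact: open_nbhs_nbhs.
    by apply: filterS => y /WP[_ -> _].
  have [_ ch] := smooth_chain fdn PsiPhi0 sPsi sPhi near_eq.
  exact: (esym (etrans (esym (diff_fun_id 0 v)) (etrans (ch v _ erefl) (dPhi _)))).
- move=> x [Ux Ax]; have [WPx PPx sPx] := UP _ Ux.
  split; [by split=> //=; rewrite PPx|exact: PPx|exact: sPx|].
  by rewrite (DE (Phi x)).
- move=> y [Wy Ay]; have [UPy PPy sPy] := WP _ Wy.
  by split.
Qed.

Lemma kernel_basis n m (A : 'M[R]_(n, m)) : row_full A ->
  exists (K : 'M[R]_(n - m, n)) (C : 'M[R]_(n, n - m)),
  [/\ K *m C = 1%:M, K *m A = 0 & forall v : 'rV[R]_n, v *m A = 0 -> v *m C *m K = v].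
Proof.
move=> /eqP rA; have rk : \rank (kermx A) = (n - m)%N by rewrite mxrank_ker rA.
suff [K [freeK KA]] : exists K : 'M[R]_(n - m, n), row_free K /\ (K == kermx A)%MS.
  exists K, (pinvmx K); split; first exact: mulmxVp.
    by apply/sub_kermxP; case/andP: KA.
  by move=> v /sub_kermxP vA; apply: mulmxKpV; apply: submx_trans vA _; case/andP: KA.
case: _ / rk; exists (row_base (kermx A)); split; first exact: row_base_free.
exact/eqmxP/eq_row_base.
Qed.

Lemma smooth_at_mulmxr n p (K : 'M[R]_(n, p)) (z : 'rV[R]_n) :
  smooth_at (fun x : 'rV[R]_n => x *m K) z.
Proof. exact: (@smooth_at_lin R _ _ (mulmxr K) z (fin_dim_rV R n)). Qed.

Lemma diff_mulmxr n p (K : 'M[R]_(n, p)) (z v : 'rV[R]_n) :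
  'd (fun x : 'rV[R]_n => x *m K) z v = v *m K.
Proof. exact: (@diff_linear _ _ (mulmxr K) z v (fin_dim_rV R n)). Qed.

End Straightening.

(** * The fibre of a submersion as a manifold *)

Section Fibre.
Variable R : realType.
Implicit Types M N P L : manifold R.

Lemma diff_coord_param M (c : chart R M (mdim M)) p v : atlas c -> dom c p ->
  'd (coord c \o param c) (coord c p) v = v.
Proof.
move=> ac cp; have near_eq : \forall z \near coord c p, z = (coord c \o param c) z.
  by apply: filterS (near_chart_image ac cp) => z /(chart_imageP ac)[_ /= ->].
have [_ d_eq] := @near_eq_is_diff _ _ _ (fun z => z) _ _ near_eq (smooth_at_diff (smooth_at_id _)).
exact: etrans (congr1 (@^~ v) d_eq) (diff_fun_id _ _).
Qed.

Section InitialTopology.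
Variables (S : choiceType) (T : topologicalType) (i : S -> T).
Local Notation W := (initial_topology i).

Lemma near_initial (y : W) (P : set T) : (\forall t \near i y, P t) -> \forall z \near y, P (i z).
Proof. exact: (@initial_continuous _ _ i y). Qed.

Lemma continuous_initial (X : topologicalType) (g : X -> W) x :
  {for x, continuous (i \o g)} -> {for x, continuous g}.
Proof.
move=> cg A; rewrite nbhsE => -[_ [[C oC <-] Cgx] CA].
apply: (@filterS _ (nbhs x) _ ((i \o g) @^-1` C)); first by move=> z; exact: CA.
by apply: cg; exact: open_nbhs_nbhs.
Qed.

Lemma hausdorff_initial : injective i -> hausdorff_space T -> hausdorff_space W.
Proof.
move=> inji hT x y clxy; apply: inji; apply: hT => A B nA nB.
have [z [Az Bz]] := clxy _ _ (near_initial nA) (near_initial nB).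
by exists (i z).
Qed.

Lemma second_countable_initial : @second_countable T -> @second_countable W.
Proof.
move=> [B cB [oB Bb]]; exists [set i @^-1` b | b in B].
  by apply: sub_countable cB; exact: card_image_le.
split=> [_ [b Bb' <-]|x A]; first by exists b => //; exact: oB.
rewrite nbhsE => -[_ [[C oC <-] Cx] CA].
have [b [Bb' bx] bC] := Bb (i x) C (open_nbhs_nbhs (conj oC Cx)).
by exists (i @^-1` b); [split=> //; exists b | move=> z /bC Cz; exact: CA].
Qed.

End InitialTopology.

Section FibreOfSubmersion.
Variables (H M : manifold R) (f : H -> M) (m : M).
Hypothesis subf : submersion f.

Definition fibre := initial_topology (set_val : f @^-1` [set m] -> H).
Definition fibre_incl : fibre -> H := set_val.
Local Notation k := (mdim H - mdim M)%N.
Local Notation incl := fibre_incl.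

Lemma fibre_eq (y : fibre) : f (incl y) = m.
Proof. exact: (set_mem (valP (y : set_type _))). Qed.

Lemma fibre_incl_inj : injective incl.
Proof. by move=> x y; exact: val_inj. Qed.

Lemma fibre_inclP h : f h = m -> exists y, incl y = h.
Proof.
move=> fh; have hA : h \in f @^-1` [set m] by rewrite inE.
by exists (SigSub hA).
Qed.

Lemma fibre_incl_cont : continuous incl.
Proof. exact: initial_continuous. Qed.

(** Besides being a chart around [q], [c] is related to the charts of [H] in both directions: its
    coordinates extend to a smooth map [ext] on [H], and its inverse is smooth as a map to [H].
    The former is what makes transition maps smooth, the latter what makes the inclusion
    smooth. The last clause describes the tangent map of the inclusion at [q]. *)
Definition slice_chart (q : fibre) (c : chart R fibre k) : Prop :=
  [/\ is_chart c, dom c q,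
    exists ext : H -> 'rV[R]_k, forall y, dom c y -> coord c y = ext (incl y) /\
      smooth_at (ext \o param (chart_at (incl y))) (loc (incl y) (incl y)),
    forall y, dom c y -> smooth_at (loc (incl y) \o incl \o param c) (coord c y) &
    injective ('d (loc (incl q) \o incl \o param c) (coord c q)) /\
    range ('d (loc (incl q) \o incl \o param c) (coord c q)) = [set v | tmap f (incl q) v = 0]].

(** Where Phi straightens f, the fibre is the set of points where D (Phi x) = 0, so that Phi
    identifies it with an open part of the kernel of D. The rows of K form a basis of this kernel
    and C reads the coordinates in this basis. *)
Lemma slice_chart_exists q : exists c, slice_chart q c.
Proof.
have [sf surj] := subf.
pose h := chart_at (incl q); pose o := f (incl q).
have ah : atlas h := chart_at_atlas _. have hq : dom h (incl q) := chart_at_dom _.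
have ao : atlas (chart_at o) := chart_at_atlas _. have oo : dom (chart_at o) o := chart_at_dom _.
have fo (y : fibre) : f (incl y) = o by rewrite /o !fibre_eq.
pose x0 := loc (incl q) (incl q).
pose fh := loc o \o f \o param h.
have fhs : smooth_at fh x0 := (smooth_msmooth (incl q) sf).2.
have fh0 : fh x0 = loc o o by rewrite /fh /x0 /= locK.
pose A := [set z | chart_image h z /\ dom (chart_at o) (f (param h z))].
have nA : \forall x \near x0, A x.
  apply: filterI; first exact: near_chart_image.
  apply: (@near_chart _ _ (incl q) (fun t => dom (chart_at o) (f t))).
  by apply: (sf.1 (incl q)); exact: near_dom.
have [U [W [Phi [Psi [[[oU Ux0] [oW W0]] UA [Phi0 dPsi] UP WP]]]]] :=
  submersion_straighten fhs (surj (incl q)) nA.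
have [D DE] : exists D : {linear 'rV[R]_(mdim H) -> 'rV[R]_(mdim M)},
    forall v, tmap f (incl q) v = D v by exists ('d fh x0).
have rfD : row_full (lin1_mx D).
  by apply: surjective_row_full => w; have [u] := surj (incl q) w; rewrite DE; exists u.
have fhP x : U x -> fh x = loc o o + D (Phi x).
  by move=> /UP[_ _ _ e]; exact: etrans e (congr2 +%R fh0 (DE _)).
have [K [C [KC KD DCK]]] := kernel_basis rfD.
have DK z : D (z *m K) = 0 by rewrite -mul_rV_lin1 -mulmxA KD mulmx0.
have kerD v : D v = 0 -> v *m C *m K = v by move=> Dv; apply: DCK; rewrite mul_rV_lin1.
have cC z : {for z, continuous (fun x : 'rV[R]_(mdim H) => x *m C)}.
  exact: smooth_at_cont (smooth_at_mulmxr C z).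
have cK z : {for z, continuous (fun x : 'rV[R]_k => x *m K)}.
  exact: smooth_at_cont (smooth_at_mulmxr K z).
pose dm := [set y : fibre | dom h (incl y) /\ U (loc (incl q) (incl y))].
pose g (z : 'rV[R]_k) := param h (Psi (z *m K)).
pose co (y : fibre) : 'rV[R]_k := Phi (loc (incl q) (incl y)) *m C.
(* The default value q is never reached on the image of the chart, by gP. *)
pose pa (z : 'rV[R]_k) : fibre := xget q [set y | incl y = g z].
have PhiCK y : dm y -> Phi (loc (incl q) (incl y)) *m C *m K = Phi (loc (incl q) (incl y)).
  move=> [hy Uy]; apply: kerD; apply/(addrI (loc o o)); rewrite addr0 -fhP//.
  by rewrite /fh /= locK// fo.
(* The slice stays in the fibre, because D vanishes on the rows of K. *)
have gP (z : 'rV[R]_k) : W (z *m K) ->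
    [/\ f (g z) = o, dom h (g z), loc (incl q) (g z) = Psi (z *m K) & incl (pa z) = g z].
  move=> /WP[Up PhiPsi _]; have [ip dp] := UA _ Up.
  have [dg lg] := chart_imageP ah ip.
  have fgz : f (g z) = o.
    have : loc o (f (g z)) = loc o o.
      by have := fhP _ Up; rewrite PhiPsi DK addr0.
    by move=> /(congr1 (param (chart_at o))); rewrite !locK.
  split=> //; rewrite /pa; case: xgetP => // nex.
  have [y yg] : exists y, incl y = g z by apply: fibre_inclP; rewrite fgz /o fibre_eq.
  by case: (nex y).
pose c := Chart dm co pa.
have imgE : chart_image c = [set z | W (z *m K)].
  apply/seteqP; split=> [_ [y dy <-]|z Wz].
    by rewrite /= PhiCK//; have [_ /UP[]] := dy.
  have [fg dg lg ig] := gP _ Wz; have [Up PP _] := WP _ Wz.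
  exists (pa z); first by split; rewrite ig ?lg.
  by rewrite /= /co ig lg PP -mulmxA KC mulmx1.
have coK y : dm y -> pa (co y) = y.
  move=> dy; have Wy : W (co y *m K) by rewrite PhiCK//; have [_ /UP[]] := dy.
  have [_ _ _ ig] := gP _ Wy; apply: fibre_incl_inj; rewrite ig /g /co PhiCK//.
  by have [hy /UP[_ -> _ _]] := dy; rewrite locK.
have odm : open dm.
  rewrite openE => y [hy Uy].
  have n1 : \forall t \near incl y, dom h t /\ U (loc (incl q) t).
    have nU : \forall z \near loc (incl q) (incl y), U z by exact: open_nbhs_nbhs.
    exact: filterS2 (fun _ a b => conj a b) (near_dom ah hy) (near_coord ah hy nU).
  exact: (near_initial n1).
have oW' : open [set z : 'rV[R]_k | W (z *m K)].
  exact: (open_comp (fun z _ => cK z) oW).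
have gs (z : 'rV[R]_k) : W (z *m K) -> smooth_at (fun z : 'rV[R]_k => Psi (z *m K)) z.
  move=> /WP[_ _ sP].
  have near_eq : \forall z' \near z, Psi (z' *m K) = Psi (z' *m K)
    := near_refl (fun z' : 'rV[R]_k => Psi (z' *m K)) z.
  exact: (smooth_chain (fin_dim_rV R _) erefl (smooth_at_mulmxr K z) sP near_eq).1.
have nW (z : 'rV[R]_k) : W (z *m K) -> \forall z' \near z, W (z' *m K).
  by move=> Wz; exact: (open_nbhs_nbhs (conj oW' Wz)).
have gcont (z : 'rV[R]_k) : W (z *m K) -> {for z, continuous g}.
  move=> Wz; apply: continuous_comp; first exact: smooth_at_cont (gs _ Wz).
  have [_ dg lg _] := gP _ Wz; rewrite -lg; exact: param_cont.
have ipcont (z : 'rV[R]_k) : W (z *m K) -> {for z, continuous (incl \o pa)}.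
  move=> Wz; apply: near_eq_continuous (gcont z Wz).
  by apply: filterS (nW _ Wz) => z' /gP[].
have incl_s (z : 'rV[R]_k) d : W (z *m K) -> atlas d -> dom d (g z) ->
    smooth_at (coord d \o incl \o pa) z /\ forall v w, 'd (fun z : 'rV[R]_k => Psi (z *m K)) z v = w ->
      'd (coord d \o incl \o pa) z v = 'd (coord d \o param h) (Psi (z *m K)) w.
  move=> Wz ad dd; have [_ dg lg ig] := gP _ Wz.
  have ts : smooth_at (coord d \o param h) (Psi (z *m K)).
    by rewrite -lg; exact: transition_smooth.
  apply: (smooth_chain (fin_dim_rV R _) erefl (gs _ Wz) ts).
  by apply: filterS (nW _ Wz) => z' /gP[_ _ _ /= ->].
have Wco y : dm y -> W (co y *m K) by move=> dy; rewrite PhiCK//; have [_ /UP[]] := dy.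
have gco y : dm y -> g (co y) = incl y.
  by move=> dy; have [_ _ _ <-] := gP _ (Wco _ dy); rewrite coK.
have dmq : dm q by [].
have coq : co q = 0 by rewrite /co -/x0 Phi0 mul0mx.
exists c; split=> //.
- split=> //.
  + by rewrite imgE.
  + move=> y /[!inE] -[hy Uy].
    have cl : {for y, continuous (loc (incl q) \o incl)}.
      exact: continuous_comp (@fibre_incl_cont y) (coord_cont ah hy).
    have cP : {for y, continuous (Phi \o (loc (incl q) \o incl))}.
      by apply: (continuous_comp cl); have [_ _ /smooth_at_cont] := UP _ Uy.
    exact: (@continuous_comp _ _ _ _ (fun x : 'rV[R]_(mdim H) => x *m C) _ cP (cC _)).
  + rewrite imgE => z /[!inE] Wz; apply: continuous_initial; exact: ipcont.
- exists (fun t => Phi (loc (incl q) t) *m C) => y dy; split=> //.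
  have [hy Uy] := dy.
  have ts : smooth_at (coord h \o param (chart_at (incl y))) (loc (incl y) (incl y)).
    apply: transition_smooth => //; [exact: chart_at_atlas|exact: chart_at_dom].
  have e1 : (coord h \o param (chart_at (incl y))) (loc (incl y) (incl y)) = loc (incl q) (incl y).
    by rewrite /= locK//; exact: chart_at_dom.
  have [_ _ Ps _] := UP _ Uy.
  have [s1 _] := smooth_chain_comp (fin_dim_rV R _) e1 ts Ps.
  exact: (smooth_chain_comp (fin_dim_rV R _) erefl s1 (smooth_at_mulmxr C _)).1.
- move=> y dy; apply: (incl_s _ _ (Wco _ dy) (chart_at_atlas _) _).1.
  by rewrite gco//; exact: chart_at_dom.
have dE u : 'd (loc (incl q) \o incl \o param c) (coord c q) u = u *m K.
  have Wq := Wco _ dmq.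
  have dq : dom (chart_at (incl q)) (g (co q)) by rewrite gco.
  have [_ ch] := incl_s _ _ Wq (chart_at_atlas _) dq.
  have lin0 : (fun x : 'rV[R]_k => x *m K) (co q) = 0 by rewrite /= coq mul0mx.
  have sP0 : smooth_at Psi 0 by have [] := WP _ W0.
  have near_eq : \forall z \near co q, Psi (z *m K) = Psi (z *m K)
    := near_refl (fun z : 'rV[R]_k => Psi (z *m K)) (co q).
  have [_ chK] := @smooth_chain _ _ _ _ (fun x : 'rV[R]_k => x *m K) Psi _ (co q) 0
    (fin_dim_rV R _) lin0 (smooth_at_mulmxr K (co q)) sP0 near_eq.
  have e1 := chK u _ (diff_mulmxr K (co q) u).
  apply: (etrans (ch u _ (etrans e1 (dPsi _)))).
  have xe : Psi (co q *m K) = x0 by have [_ _ <- _] := gP _ Wq; rewrite (gco q dmq).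
  rewrite xe; exact: (@diff_coord_param _ (chart_at (incl q)) (incl q) (u *m K) ah hq).
split.
  move=> u v; rewrite !dE => /(congr1 (mulmx^~ C)).
  by rewrite -!mulmxA KC !mulmx1.
apply/seteqP; split=> [_ [u _ <-]|v /=]; first by rewrite dE /= DE DK.
by rewrite DE => /kerD vE; exists (v *m C) => //; rewrite dE.
Qed.

End FibreOfSubmersion.
End Fibre.

Section FibreManifold.
Variable R : realType.
Variables (H M : manifold R) (f : H -> M) (m : M).
Hypothesis subf : submersion f.
Local Notation k := (mdim H - mdim M)%N.
Local Notation T := (fibre f m).
Local Notation incl := (@fibre_incl R H M f m).

(** The second chart is the restriction of a smooth map on H, and the inverse of the first one is
    a smooth map into H. *)
Lemma slice_transition_smooth (p q : T) (c d : chart R T k) :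
  slice_chart p c -> slice_chart q d ->
  smooth_on (coord c @` (dom c `&` dom d)) (coord d \o param c).
Proof.
move=> [cc _ _ inclc _] [dd _ [ext extP] _ _].
have [odc _ ccont pcont coK] := cc; have odd' : open (dom d) by case: dd.
apply/smooth_on_germ; first exact: is_chart_open_image.
move=> _ [y [cy dy] <-].
have [_ exts] := extP y dy.
have cpar : {for coord c y, continuous (param c)} by apply: pcont; rewrite inE; exists y.
have ipar : {for coord c y, continuous (incl \o param c)}.
  by apply: (continuous_comp cpar); exact: fibre_incl_cont.
have n1 : \forall z \near coord c y, dom d (param c z).
  by apply: cpar; rewrite coK//; exact: open_nbhs_nbhs.
have n2 : \forall z \near coord c y, dom (chart_at (incl y)) (incl (param c z)).
  apply: ipar; rewrite /= coK//.
  by apply: near_dom; [exact: chart_at_atlas|exact: chart_at_dom].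
have e1 : (loc (incl y) \o incl \o param c) (coord c y) = loc (incl y) (incl y) by rewrite /= coK.
apply: (smooth_chain (fin_dim_rV R _) e1 (inclc y cy) exts _).1.
apply: filterS2 n1 n2 => z dz hz.
by have [e _] := extP _ dz; rewrite /= locK// e.
Qed.

Lemma fibre_connected : connected (f @^-1` [set m]) -> connected [set: T].
Proof.
move=> conA B [b Bb] [_ [U oU <-] BU] [C clC BC].
have [U' oU' U'C] : open (~` C) by exact: closed_openC.
have inclA (y : T) : (f @^-1` [set m]) (incl y) by exact: fibre_eq.
have BE : incl @` B = f @^-1` [set m].
  apply: conA; first by exists (incl b), b.
  - exists U => //; apply/seteqP; split=> [_ [y By <-]|h [Ah Uh]].
      by split; [exact: inclA | move: By; rewrite BU => -[]].
    have [y yh] := fibre_inclP Ah; exists y => //.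
    by rewrite BU; split=> //=; rewrite -[set_val y]/(incl y) yh.
  - exists (~` U'); first exact: open_closedC.
    apply/seteqP; split=> [_ [y By <-]|h [Ah Uh]].
      split; first exact: inclA.
      move=> U'y; have : (~` C) y by rewrite -U'C.
      by apply; move: By; rewrite BC => -[].
    have [y yh] := fibre_inclP Ah; exists y => //.
    rewrite BC; split=> //; apply: contrapT => nC; apply: Uh.
    have : (set_val @^-1` U') y by rewrite U'C.
    by rewrite /= -[set_val y]/(incl y) yh.
apply/seteqP; split=> // y _.
have : (f @^-1` [set m]) (incl y) by exact: inclA.
by rewrite -BE => -[y' By' /fibre_incl_inj <-].
Qed.

(** The regular value theorem, with connectedness for the only trace of the topology of L. *)
Theorem fibre_submanifold : exists (L : manifold R) (i : L -> H),
  [/\ mdim L = k, smooth i /\ injective i, range i = f @^-1` [set m],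
      connected (f @^-1` [set m]) -> connected [set: L] &
      forall y, injective (tmap i y) /\ range (tmap i y) = [set v | tmap f (i y) v = 0]].
Proof.
have [cc ccP] := choice (slice_chart_exists (m := m) subf).
pose L := @Manifold R T k (range cc) cc
  (hausdorff_initial (@fibre_incl_inj _ _ _ f m) (manifold_hausdorff (m:=H)))
  (@second_countable_initial _ _ _ (manifold_countable H))
  (fun c '(ex_intro2 q _ e) => let: And5 h _ _ _ _ := ccP q in eq_ind _ _ h _ e)
  (fun c d '(ex_intro2 q _ e) '(ex_intro2 q' _ e') =>
     eq_ind _ (fun c => smooth_on (coord c @` (dom c `&` dom d)) (coord d \o param c))
      (eq_ind _ (fun d => smooth_on (coord (cc q) @` (dom (cc q) `&` dom d)) (coord d \o param (cc q)))
       (slice_transition_smooth (ccP q) (ccP q')) _ e') _ e)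
  (fun q => imageT cc q) (fun q => let: And5 _ h _ _ _ := ccP q in h).
exists L, incl; split=> //.
- split; last exact: fibre_incl_inj.
  apply/smoothP => y; apply: (@msmooth_of_charts R L H incl y (cc y) (chart_at (incl y))).
  + exact: imageT.
  + exact: chart_at_atlas.
  + by have [] := ccP y.
  + exact: chart_at_dom.
  + exact: fibre_incl_cont.
  + by have [_ dy _ h _] := ccP y; exact: h.
- apply/seteqP; split=> [_ [y _ <-]|h fh]; first exact: fibre_eq.
  by have [y <-] := fibre_inclP fh; exists y.
- exact: fibre_connected.
- by move=> y; have [_ _ _ _ []] := ccP y.
Qed.

End FibreManifold.

(** * Curves *)

Section Curves.
Variable R : realType.
Implicit Types M N P L : manifold R.

Definition curve_at M (g : R -> M) (t : R) :=
  {for t, continuous g} /\ smooth_at (loc (g t) \o g) t.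

Lemma curve_charts M (g : R -> M) t (c d : chart R M (mdim M)) :
  {for t, continuous g} -> atlas c -> atlas d -> dom c (g t) -> dom d (g t) ->
  smooth_at (coord c \o g) t -> smooth_at (coord d \o g) t.
Proof.
move=> cg ac ad ct dt gs.
apply: (smooth_chain (fin_dim_rV R _) erefl gs (transition_smooth ac ad ct dt) _).1.
have n : \forall s \near t, dom c (g s) by apply: cg; exact: near_dom.
by apply: filterS n => s cs; rewrite /= (coordK ac cs).
Qed.

Lemma smooth_curveP M (g : R -> M) : smooth_curve g <-> forall t, curve_at g t.
Proof.
split=> [[cg gs] t|gs].
  split; first exact: cg.
  exists (g @^-1` dom (chart_at (g t))); last by apply: gs; exact: chart_at_atlas.
  split; last exact: chart_at_dom.
  by apply: open_comp => [x _|]; [exact: cg|apply: chart_open; exact: chart_at_atlas].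
have cg : continuous g by move=> t; case: (gs t).
split=> // c ac; apply/smooth_on_germ.
  by apply: open_comp => [x _|]; [exact: cg|exact: chart_open].
move=> t ct; have [_ gt] := gs t.
exact: (curve_charts (cg t) (chart_at_atlas _) ac (chart_at_dom _) ct gt).
Qed.

Lemma velocityE M (g : R -> M) t : curve_at g t -> velocity g t = 'd (loc (g t) \o g) t 1.
Proof. by move=> [_ gs]; rewrite /velocity derive1E'//; exact: smooth_at_diff. Qed.

Lemma velocity_comp M N (g : R -> M) (f : M -> N) t :
  curve_at g t -> msmooth_at f (g t) ->
  curve_at (f \o g) t /\ velocity (f \o g) t = tmap f (g t) (velocity g t).
Proof.
move=> cgt [cf fs]; have [cg gs] := cgt.
have near_eq : \forall s \near t, (loc (f (g t)) \o (f \o g)) s =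
    (loc (f (g t)) \o f \o param (chart_at (g t))) ((loc (g t) \o g) s).
  have n : \forall s \near t, dom (chart_at (g t)) (g s).
    by apply: cg; apply: near_dom; [exact: chart_at_atlas|exact: chart_at_dom].
  by apply: filterS n => s ds; rewrite /= locK.
have [s12 d12] := smooth_chain (fin_dim_rV R _) erefl gs fs near_eq.
have cfg : curve_at (f \o g) t by split; [exact: continuous_comp | exact: s12].
split; first exact: cfg.
apply: (etrans (velocityE cfg)); exact: (d12 1 _ (esym (velocityE cgt))).
Qed.

(** The map t |-> t / (1 + (t / e)^2) sends the line into the interval ]-e, e[ and has derivative 1
    at 0. It turns a curve defined near 0 into one defined for all times, with the same velocity
    at 0. *)
Definition squeeze (e t : R) := (1 + (t / e) ^+ 2)^-1 * t.

Lemma squeeze_lt (e t : R) : 0 < e -> `|squeeze e t| < e.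
Proof.
move=> e0; rewrite /squeeze normrM.
have p0 : 0 < 1 + (t / e) ^+ 2 by rewrite ltr_pwDl// sqr_ge0.
rewrite ger0_norm ?invr_ge0 ?ltW// mulrC ltr_pdivrMr//.
have -> : `|t| = `|t / e| * e by rewrite normrM normfV (gtr0_norm e0) divfK// gt_eqF.
rewrite mulrC ltr_pM2l// -real_normK ?num_real//.
by have := sqr_ge0 (`|t / e| - 2^-1); nra.
Qed.

Lemma squeeze0 (e : R) : squeeze e 0 = 0.
Proof. by rewrite /squeeze mulr0. Qed.

Lemma squeeze_factor_smooth (e t : R) : smooth_at (fun t : R => (1 + (t / e) ^+ 2)^-1) t.
Proof.
have oT : open [set: R] := openT.
exists setT => // k; have idk : Ck_on k setT (fun t : R => t).
  by apply: (@Ck_linear R R R k setT idfun) => x; exact: cvg_id.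
have p0 (s : R) : 1 + (s / e) ^+ 2 != 0 by rewrite gt_eqF// ltr_pwDl// sqr_ge0.
apply: CkV => //; apply: CkD => //; first exact: Ck_cst.
have xe : Ck_on k setT (fun x : R => x / e) by apply: CkM => //; exact: Ck_cst.
exact: CkM.
Qed.

Lemma squeeze_smooth (e t : R) : smooth_at (squeeze e) t.
Proof. exact: smooth_atZ (squeeze_factor_smooth e t) (smooth_at_id t). Qed.

Lemma diff_squeeze0 (e : R) : 'd (squeeze e) 0 1 = 1.
Proof.
have cs := squeeze_factor_smooth e 0.
have [_ h] := diff_scale (smooth_at_diff cs) (smooth_at_diff (@smooth_at_id R R 0)).
apply: (etrans (congr1 (@^~ 1) h)); rewrite /= diff_fun_id scaler0 addr0 mul0r expr0n addr0 invr1.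
exact: scale1r.
Qed.

(** The reparametrisation phi keeps time within any prescribed neighbourhood P of 0, where the
    germ is under control. *)
Lemma curve_of_germ M (p : M) (eta : R -> Tsp M) (P : set R) :
  smooth_at eta 0 -> eta 0 = loc p p -> (\forall t \near (0 : R), P t) ->
  exists (phi : R -> R) (g : R -> M), [/\ smooth_curve g, g 0 = p, velocity g 0 = 'd eta 0 1 &
    forall t, P (phi t) /\ g t = param (chart_at p) (eta (phi t))].
Proof.
move=> es e0 nP; have ac := chart_at_atlas p; have dp := chart_at_dom p.
have nI : \forall t \near (0 : R), chart_image (chart_at p) (eta t).
  by apply: (smooth_at_cont es); rewrite e0; exact: near_chart_image.
have : \forall t \near (0 : R), [/\ P t, chart_image (chart_at p) (eta t) & smooth_at eta t].
  by apply: filterS3 nP nI (smooth_at_near es).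
rewrite -nbhs_nearE => /nbhs_normP[e /= e_gt0 eP].
have {}eP t : [/\ P (squeeze e t), chart_image (chart_at p) (eta (squeeze e t)) &
    smooth_at eta (squeeze e t)].
  by apply: eP; rewrite /= sub0r normrN squeeze_lt.
pose g t := param (chart_at p) (eta (squeeze e t)).
have gs t : smooth_at (loc p \o g) t /\ 'd (loc p \o g) t 1 = 'd eta (squeeze e t) ('d (squeeze e) t 1).
  have [_ _ es'] := eP t.
  have near_eq : \forall s \near t, (loc p \o g) s = eta (squeeze e s).
    apply: (@near_all R R) => s; have [_ im _] := eP s.
    exact: loc_param.
  have [s12 d12] := smooth_chain (fin_dim_R R) erefl (squeeze_smooth e t) es' near_eq.
  by split; [exact: s12 | exact: d12].
have gd t : dom (chart_at p) (g t).
  by have [_ im _] := eP t; have [] := chart_imageP ac im.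
have gc t : {for t, continuous g}.
  have [_ im es'] := eP t; have [dgt lgt] := chart_imageP ac im.
  have c1 : {for t, continuous (eta \o squeeze e)}.
    by apply: continuous_comp; apply: smooth_at_cont => //; exact: squeeze_smooth.
  have c2 : {for (eta \o squeeze e) t, continuous (param (chart_at p))}.
    by rewrite /= -lgt; exact: param_cont.
  exact: (continuous_comp c1 c2).
have g0 : g 0 = p by rewrite /g squeeze0 e0 locK.
have curve t : curve_at g t.
  split; first exact: gc.
  by apply: (curve_charts (gc t) ac (chart_at_atlas _) (gd t) (chart_at_dom _)); have [] := gs t.
exists (squeeze e), g; split=> //.
- exact/smooth_curveP.
- apply: (etrans (velocityE (curve 0))); rewrite g0.
  apply: (etrans (gs 0).2); rewrite squeeze0 diff_squeeze0.
  by [].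
- by move=> t; have [] := eP t.
Qed.

Lemma exists_curve M (p : M) (v : Tsp M) :
  exists g : R -> M, [/\ smooth_curve g, g 0 = p & velocity g 0 = v].
Proof.
pose l (t : R) := t *: v.
have ls : smooth_at l 0 by apply: smooth_atZ; [exact: smooth_at_id | exact: smooth_at_cst].
have es : smooth_at (fun t => l t + loc p p) 0 by apply: smooth_atD => //; exact: smooth_at_cst.
have e0 : (fun t => l t + loc p p) 0 = loc p p by rewrite /l scale0r add0r.
have [phi [g [gs g0 gv _]]] := @curve_of_germ M p _ setT es e0 (@near_all R R _ 0 (fun=> I)).
exists g; split=> //; apply: (etrans gv).
have [_ d1] := diff_fun_add (smooth_at_diff ls) (smooth_at_diff (smooth_at_cst (loc p p) (0 : R))).
apply: (etrans (d1 1)).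
have [_ d2] := diff_scale (smooth_at_diff (@smooth_at_id R R 0)) (smooth_at_diff (smooth_at_cst v (0 : R))).
have e2 := congr1 (@^~ 1) d2.
have e3 := congr1 (@^~ 1) (@diff_cst R R _ (loc p p) 0).
have e4 := congr1 (@^~ 1) (@diff_cst R R _ v 0).
apply: (etrans (congr2 +%R e2 e3)); rewrite /= addr0 scale0r add0r.
by rewrite diff_fun_id scale1r.
Qed.

End Curves.

(** * Lifting curves, and maps with zero tangent map *)

Section Lifting.
Variable R : realType.
Implicit Types M N P L : manifold R.

(** In straightened coordinates f is a linear map D with a right inverse B, and a lift of the
    curve a is the curve a t B + t (v - D v B), whose velocity can be prescribed within the
    kernel of D. *)
Lemma submersion_lift M N (f : M -> N) (p : M) (v : Tsp M) (k : R -> N) :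
  submersion f -> smooth_curve k -> k 0 = f p -> velocity k 0 = tmap f p v ->
  exists (phi : R -> R) (g : R -> M), [/\ smooth_curve g, forall t, f (g t) = k (phi t),
    g 0 = p & velocity g 0 = v].
Proof.
move=> [sf surj] /smooth_curveP sk k0 kv; have sk0 := sk 0.
pose h := chart_at p; pose o := f p; pose x0 := loc p p.
have ah : atlas h := chart_at_atlas _. have hp : dom h p := chart_at_dom _.
have ao : atlas (chart_at o) := chart_at_atlas _. have oo : dom (chart_at o) o := chart_at_dom _.
pose fh := loc o \o f \o param h.
have fhs : smooth_at fh x0 := (smooth_msmooth p sf).2.
have fh0 : fh x0 = loc o o by rewrite /fh /x0 /= locK.
pose A := [set z | chart_image h z /\ dom (chart_at o) (f (param h z))].
have nA : \forall x \near x0, A x.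
  apply: filterI; first exact: near_chart_image.
  by apply: (@near_chart _ _ p (fun t => dom (chart_at o) (f t))); apply: (sf.1 p); exact: near_dom.
have [U [W [Phi [Psi [[[oU Ux0] [oW W0]] UA [Phi0 dPsi] UP WP]]]]] :=
  submersion_straighten fhs (surj p) nA.
have [D [DE Dsurj]] : exists D : {linear 'rV[R]_(mdim M) -> 'rV[R]_(mdim N)},
    (forall v, tmap f p v = D v) /\ forall w, exists u, D u = w.
  by exists ('d fh x0); split=> // w; have [u] := surj p w; exists u.
have fhP x : U x -> fh x = loc o o + D (Phi x).
  by move=> /UP[_ _ _ e]; exact: etrans e (congr2 +%R fh0 (DE _)).
have /row_fullP[B BD] := surjective_row_full Dsurj.
have DB w : D (w *m B) = w by rewrite -mul_rV_lin1 -mulmxA BD mulmx1.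
pose kap := loc o \o k.
have kaps : smooth_at kap 0 by have [_] := sk0; rewrite k0.
have kap0 : kap 0 = loc o o by rewrite /kap /= k0.
have dkap : 'd kap 0 1 = D v.
  by have := velocityE sk0; rewrite k0 kv DE => ->.
pose a t := kap t - loc o o.
have as_ : smooth_at a 0 by apply: smooth_atB => //; exact: smooth_at_cst.
have a0 : a 0 = 0 by rewrite /a kap0 subrr.
have da : 'd a 0 1 = D v.
  have [_ d1] := diff_fun_sub (smooth_at_diff kaps) (smooth_at_diff (smooth_at_cst (loc o o) (0 : R))).
  apply: (etrans (d1 1)); have e3 := congr1 (@^~ 1) (@diff_cst R R _ (loc o o) 0).
  by apply: (etrans (congr2 (fun x y => x - y) dkap e3)); rewrite subr0.
have near_aB : \forall t \near (0 : R), a t *m B = a t *m B by exact: near_all.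
have [aBs daB] := @smooth_chain _ _ _ _ a (fun x : 'rV[R]_(mdim N) => x *m B) (fun t => a t *m B) 0 _
  (fin_dim_rV R _) a0 as_ (smooth_at_mulmxr B 0) near_aB.
pose eta t := a t *m B + t *: (v - D v *m B).
have ls : smooth_at (fun t : R => t *: (v - D v *m B)) 0.
  by apply: smooth_atZ; [exact: smooth_at_id | exact: smooth_at_cst].
have etas : smooth_at eta 0 by exact: smooth_atD.
have eta0 : eta 0 = 0 by rewrite /eta a0 mul0mx scale0r addr0.
have deta : 'd eta 0 1 = v.
  have [_ d1] := diff_fun_add (smooth_at_diff aBs) (smooth_at_diff ls).
  have [_ d2] := diff_scale (smooth_at_diff (@smooth_at_id R R 0))
    (smooth_at_diff (smooth_at_cst (v - D v *m B) (0 : R))).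
  have e2 := congr1 (@^~ 1) d2.
  have e4 := congr1 (@^~ 1) (@diff_cst R R _ (v - D v *m B) 0).
  have e1 := etrans (daB 1 _ da) (diff_mulmxr B 0 (D v)).
  apply: (etrans (d1 1)); apply: (etrans (congr2 +%R e1 e2)).
  by rewrite /= scale0r add0r diff_fun_id scale1r subrKC.
have Deta t : D (eta t) = a t.
  by rewrite /eta linearD linearZ/= linearB !DB subrr scaler0 addr0.
have Psi0 : Psi 0 = x0 by have [_ + _ _] := UP _ Ux0; rewrite Phi0.
have sPsi0 : smooth_at Psi 0 by have [] := WP _ W0.
have near_Pe : \forall t \near (0 : R), (Psi \o eta) t = Psi (eta t) by exact: near_all.
have [Pes dPe] := smooth_chain (fin_dim_rV R _) eta0 etas sPsi0 near_Pe.
have Pe0 : (Psi \o eta) 0 = loc p p by rewrite /= eta0.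
have near_W : \forall t \near (0 : R), W (eta t) /\ dom (chart_at o) (k t).
  have nW : \forall t \near (0 : R), W (eta t).
    by apply: (smooth_at_cont etas); rewrite eta0; exact: open_nbhs_nbhs.
  have nk : \forall t \near (0 : R), dom (chart_at o) (k t).
    by apply: sk0.1; rewrite k0; exact: near_dom.
  by apply: filterS2 nW nk.
have [phi [g [gs g0 gv gP]]] := curve_of_germ Pes Pe0 near_W.
exists phi, g; split=> //.
- move=> t; have [[Wt kt] ->] := gP t.
  have [UPt PhiPsi _] := WP _ Wt; have [_ dt] := UA _ UPt.
  have : loc o (f (param h (Psi (eta (phi t))))) = loc o (k (phi t)).
    by have := fhP _ UPt; rewrite PhiPsi Deta /a /kap /= subrKC.
  by move=> /(congr1 (param (chart_at o))); rewrite !locK.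
- by apply: (etrans gv); apply: (etrans (dPe 1 _ deta)); exact: dPsi.
Qed.

(** For the inclusion from right to left, a curve of M with velocity x is sent to V by i, and
    lifted to D with velocity v. For the converse, a curve g in the preimage satisfies
    r o g = i o s o r o g. *)
Lemma tangent_preimage_section (D V M : manifold R) (r : D -> V) (i : M -> V) (s : V -> M)
    (p : D) (b : M) :
  submersion r -> smooth i -> smooth s -> cancel i s -> r p = i b ->
  tangent (r @^-1` range i) p = [set v | exists x : Tsp M, tmap r p v = tmap i b x].
Proof.
move=> subr si ss iK rp; have sr := subr.1.
have sb : s (r p) = b by rewrite rp iK.
apply/seteqP; split=> [v [g [gs gX g0 <-]]|v [x vx]].
- have /smooth_curveP/(_ 0) cg := gs.
  have rg t : r (g t) = i (s (r (g t))) by have [c _ <-] := gX t; rewrite iK.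
  have ssr := smooth_comp sr ss; have sisr := smooth_comp ssr si.
  exists (tmap (s \o r) (g 0) (velocity g 0)).
  have [_ e1] := velocity_comp cg (smooth_msmooth (g 0) sr).
  have [_ e2] := velocity_comp cg (smooth_msmooth (g 0) sisr).
  have e : r \o g = (i \o (s \o r)) \o g by apply: funext => t; rewrite /= {1}rg.
  have e3 := tmap_comp (g 0) (velocity g 0) ssr si.
  rewrite -e e3 in e2; rewrite -g0 -sb -g0.
  exact: (etrans (esym e1) e2).
- have [c [cs c0 cv]] := exists_curve b x.
  have /smooth_curveP/(_ 0) cc := cs.
  have ics : smooth_curve (i \o c).
    apply/smooth_curveP => t; have /smooth_curveP/(_ t) ct := cs.
    by have [] := velocity_comp ct (smooth_msmooth (c t) si).
  have [_ icv] := velocity_comp cc (smooth_msmooth (c 0) si).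
  have ic0 : (i \o c) 0 = r p by rewrite /= c0 rp.
  have icv' : velocity (i \o c) 0 = tmap r p v by rewrite vx icv c0 cv.
  have [phi [g [gs gP g0 gv]]] := submersion_lift subr ics ic0 icv'.
  exists g; split=> // t; rewrite /= gP /=.
  by exists (c (phi t)).
Qed.

Lemma tmap0_locally_constant L N (f : L -> N) y : smooth f ->
  (forall z u, tmap f z u = 0) -> \forall z \near y, f z = f y.
Proof.
move=> sf df; pose c := chart_at y; pose o := f y.
have ac : atlas c := chart_at_atlas _. have cy : dom c y := chart_at_dom _.
have ao : atlas (chart_at o) := chart_at_atlas _. have oo : dom (chart_at o) o := chart_at_dom _.
pose G := loc o \o f \o param c.
have nA : \forall z \near loc y y, chart_image c z /\ dom (chart_at o) (f (param c z)).
  apply: filterI; first exact: near_chart_image.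
  by apply: (@near_chart _ _ y (fun t => dom (chart_at o) (f t))); apply: (sf.1 y); exact: near_dom.
have dG z : chart_image c z -> dom (chart_at o) (f (param c z)) ->
    smooth_at G z /\ forall v, 'd G z v = 0.
  move=> iz dz; have [cz lz] := chart_imageP ac iz; set z' := param c z in cz lz dz *.
  have [cf fs] := smooth_msmooth z' sf.
  have [s1 d1] := change_charts (chart_at_atlas z') ac (chart_at_atlas (f z')) ao
    (chart_at_dom z') cz (chart_at_dom (f z')) dz cf fs.
  rewrite lz in s1 d1; split=> [|v]; first exact: s1.
  apply: (etrans (d1 v)).
  have e := df z' ('d (coord (chart_at z') \o param c) z v).
  by rewrite /tmap in e; rewrite e linear0.
move: nA; rewrite -nbhs_nearE => /nbhs_normP[r /= r0 rA].
have nr : \forall z \near y, `|loc y y - loc y z| < r.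
  have n0 : \forall z \near loc y y, `|loc y y - z| < r.
    by apply: open_nbhs_nbhs; split; [exact: open_dist|rewrite /= subrr normr0].
  exact: near_loc n0.
have nd : \forall z \near y, dom c z by exact: near_dom.
apply: filterS2 nr nd => z rz cz.
have Gz : G (loc y z) = G (loc y y).
  apply/eqP; rewrite -subr_eq0 -normr_le0.
  have := @mean_value_rV R _ _ G (loc y y) (loc y z - loc y y) 0 (lexx _).
  rewrite subrK; apply=> t /andP[t0 t1].
  have tr : `|loc y y - (t *: (loc y z - loc y y) + loc y y)| < r.
    rewrite opprD addrCA subrr addr0 normrN normrZ ger0_norm// distrC.
    by apply: le_lt_trans rz; rewrite ler_piMl.
  have [iz dz] := rA _ tr; have [s1 d1] := dG _ iz dz.
  by split; [exact: smooth_at_diff | rewrite d1 normr0].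
have [_ dz] := rA _ rz.
move: Gz; rewrite /G /= !locK// in dz * => /(congr1 (param (chart_at o))).
by rewrite !locK.
Qed.

(** The fibres of f are open by [tmap0_locally_constant], hence also closed. *)
Lemma tmap0_constant L N (f : L -> N) y z : connected [set: L] -> smooth f ->
  (forall z u, tmap f z u = 0) -> f z = f y.
Proof.
move=> conL sf df.
have oA (P : set N) : open (f @^-1` P).
  rewrite openE => x Px; apply: filterS (tmap0_locally_constant x sf df) => x' e.
  by rewrite /= e.
have : f @^-1` [set f y] = setT.
  apply: conL; first by exists y.
  - by exists (f @^-1` [set f y]); [exact: oA|rewrite setTI].
  - exists (f @^-1` [set f y]); last by rewrite setTI.
    rewrite -[f @^-1` _]setCK; apply: open_closedC; exact: (oA (~` [set f y])).
by move=> /seteqP[_ /(_ z I)].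
Qed.

End Lifting.

(** * Symplectic groupoids *)

Section SymplecticGroupoid.
Variable R : realType.

Section LinearAlgebra.

Lemma gram_entry a b d (A : 'M[R]_(a, d)) (W : 'M[R]_d) (B : 'M[R]_(b, d)) i j :
  (A *m W *m B^T) i j = (row i A *m W *m (row j B)^T) 0 0.
Proof.
rewrite -row_mul [LHS]mxE [RHS]mxE; apply: eq_bigr => k _.
by congr (_ * _); rewrite !mxE.
Qed.

Lemma orthogonal_rank a b d (A : 'M[R]_(a, d)) (W : 'M[R]_d) (B : 'M[R]_(b, d)) :
  row_free W -> (forall i j, (row i A *m W *m (row j B)^T) 0 0 = 0) ->
  (\rank A + \rank B <= d)%N.
Proof.
move=> fW AB; have AWB : A *m W *m B^T = 0.
  by apply/matrixP => i j; rewrite gram_entry AB mxE.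
by have := mulmx0_rank_max AWB; rewrite mxrankMfree// mxrank_tr.
Qed.

(** Let S be the preimage under A of the span of the rows of B. Its orthogonal for W has
    dimension v - m because W is nondegenerate and A is onto. The span of the rows of J lies in
    this orthogonal and has the same dimension. *)
Lemma orthogonal_complement d v m k (W : 'M[R]_d) (A : 'M[R]_(d, v)) (B : 'M[R]_(m, v))
    (J : 'M[R]_(k, d)) :
  row_free W -> row_full A -> row_free B -> row_free J -> k = (v - m)%N ->
  (forall (u : 'rV_k) (y : 'rV_d) x, y *m A = x *m B -> (u *m J *m W *m y^T) 0 0 = 0) ->
  forall u : 'rV_d, (forall (y : 'rV_d) x, y *m A = x *m B -> (u *m W *m y^T) 0 0 = 0) ->
  exists x : 'rV_k, u = x *m J.
Proof.
move=> fW fA fB fJ kE JW u uW.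
pose S := kermx (A *m cokermx B).
have SP (i : 'I_d) : exists x, row i S *m A = x *m B.
  apply/submxP; rewrite submxE -mulmxA; apply/eqP/sub_kermxP.
  exact: row_sub.
pose N := kermx (W *m S^T).
have inN n (Z : 'M[R]_(n, d)) :
    (forall (i : 'I_n) (y : 'rV_d) x, y *m A = x *m B -> (row i Z *m W *m y^T) 0 0 = 0) ->
    (Z <= N)%MS.
  move=> ZW; apply/sub_kermxP; rewrite mulmxA; apply/matrixP => i j.
  by rewrite gram_entry [RHS]mxE; have [x xE] := SP j; exact: ZW xE.
have JN : (J <= N)%MS by apply: inN => i y x; rewrite rowE; exact: JW.
have uN : (u <= N)%MS.
  by apply: inN => i y x; rewrite rowE (_ : i = 0) ?ord1// -rowE row_id; exact: uW.
have rN : \rank N = k.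
  have rS : \rank S = (d - (v - m))%N.
    by rewrite mxrank_ker (eqmxMfull _ fA) mxrank_coker (eqP fB).
  rewrite mxrank_ker -mxrank_tr trmx_mul trmxK mxrankMfree; last first.
    by rewrite row_free_unit unitmx_tr -row_free_unit.
  rewrite rS kE subKn//.
  by apply: leq_trans (leq_subr _ _) _; rewrite -(eqP fA) rank_leq_row.
have NJ : (N <= J)%MS.
  by rewrite -(geq_leqif (mxrank_leqif_sup JN)) rN (eqP fJ).
by have /submxP[x ->] := submx_trans uN NJ; exists x.
Qed.

End LinearAlgebra.

Section Tangent.
Implicit Types M N P : manifold R.

Definition tmx M N (f : M -> N) p : 'M[R]_(mdim M, mdim N) :=
  lin1_mx ('d (loc (f p) \o f \o param (chart_at p)) (loc p p)).

Lemma mul_tmx M N (f : M -> N) p u : u *m tmx f p = tmap f p u.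
Proof. by rewrite mul_rV_lin1. Qed.

Lemma row_tmx M N (f : M -> N) p i : row i (tmx f p) = tmap f p (delta_mx 0 i).
Proof. by rewrite rowE mul_tmx. Qed.

Lemma tmx_full M N (f : M -> N) p : submersion f -> row_full (tmx f p).
Proof. by move=> [_ surj]; apply: surjective_row_full => w; exact: surj. Qed.

Lemma tmx_free M N (f : M -> N) p : injective (tmap f p) -> row_free (tmx f p).
Proof.
move=> inj; rewrite -kermx_eq0; apply/rowV0P => u /sub_kermxP; rewrite mul_tmx => fu.
by apply: inj; rewrite fu tmap0.
Qed.

Lemma tmap_cancel M N (f : M -> N) (g : N -> M) p u : smooth f -> smooth g ->
  cancel f g -> tmap g (f p) (tmap f p u) = u.
Proof.
move=> sf sg fK; rewrite -tmap_comp//.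
have -> : g \o f = fun x => x by apply: funext => x; exact: fK.
exact: tmap_id.
Qed.

Lemma ev0l M (w : tensor2 M) p v : ev w p 0 v = 0.
Proof. by rewrite /ev !mul0mx mxE. Qed.

Lemma ev0r M (w : tensor2 M) p u : ev w p u 0 = 0.
Proof. by rewrite /ev trmx0 mulmx0 mxE. Qed.

Lemma symplectic_free M (w : tensor2 M) p : symplectic w -> row_free (w p).
Proof.
move=> [_ _ nd]; rewrite -kermx_eq0; apply/rowV0P => u /sub_kermxP uw.
by apply: (nd p) => v; rewrite /ev uw mul0mx mxE.
Qed.

End Tangent.

Section Multiplicative.
Variables (G B : manifold R) (Q : lie_groupoid G B) (w : tensor2 G).
Hypothesis sQ : symplectic_groupoid Q w.

Lemma mul_extension g h : source Q g = target Q h ->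
  exists F, local_extension (composable Q) (product Q) g h F.
Proof. by move=> gh; exact: (@mul_smooth _ _ _ Q g h gh). Qed.

Lemma source_smooth : smooth (source Q). Proof. by case: (src_submersion Q). Qed.
Lemma target_smooth : smooth (target Q). Proof. by case: (tgt_submersion Q). Qed.
Let unit_sm : smooth (unit_map Q) := unit_smooth Q.

Lemma mul_units b : product Q (unit_map Q b) (unit_map Q b) = unit_map Q b.
Proof. by have := mul_unit_left Q (unit_map Q b); rewrite tgt_unit. Qed.

(** Differentiate g 1 = g. *)
Lemma diff_mul_unit_right g F u :
  local_extension (composable Q) (product Q) g (unit_map Q (source Q g)) F ->
  'd F (loc g g, loc (unit_map Q (source Q g)) (unit_map Q (source Q g)))
    (u, tmap (unit_map Q) (source Q g) (tmap (source Q) g u)) = u.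
Proof.
move=> Fext; pose b := unit_map Q \o source Q.
have sb : smooth b by apply: smooth_comp; [exact: source_smooth|].
have comp z : composable Q (z, b z) by rewrite /composable /b /= tgt_unit.
have := tmap_pairs u (@smooth_id R G) sb comp Fext.
rewrite tmap_id (tmap_comp _ _ source_smooth unit_sm) => <-.
have -> : (fun z => product Q z (b z)) = fun z => z.
  by apply: funext => z; rewrite mul_unit_right.
by rewrite tmap_id.
Qed.

(** Differentiate 1 g = g. *)
Lemma diff_mul_unit_left g F u :
  local_extension (composable Q) (product Q) (unit_map Q (target Q g)) g F ->
  'd F (loc (unit_map Q (target Q g)) (unit_map Q (target Q g)), loc g g)
    (tmap (unit_map Q) (target Q g) (tmap (target Q) g u), u) = u.
Proof.
move=> Fext; pose a := unit_map Q \o target Q.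
have sa : smooth a by apply: smooth_comp; [exact: target_smooth|].
have comp z : composable Q (a z, z) by rewrite /composable /a /= src_unit.
have := tmap_pairs u sa (@smooth_id R G) comp Fext.
rewrite tmap_id (tmap_comp _ _ target_smooth unit_sm) => <-.
have -> : (fun z => product Q (a z) z) = fun z => z.
  by apply: funext => z; rewrite mul_unit_left.
by rewrite tmap_id.
Qed.

(** Since 1 1 = 1, multiplicativity says that the value is twice itself. *)
Lemma unit_isotropic b x y :
  ev w (unit_map Q b) (tmap (unit_map Q) b x) (tmap (unit_map Q) b y) = 0.
Proof.
have [_ mw] := sQ; set e := unit_map Q b.
have ee : source Q e = target Q e by rewrite src_unit tgt_unit.
have [F Fext] := mul_extension ee.
have dF z : 'd F (loc e e, loc e e) (tmap (unit_map Q) b z, tmap (unit_map Q) b z) =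
    tmap (unit_map Q) b z.
  have comp z' : composable Q (unit_map Q z', unit_map Q z').
    by rewrite /composable /= src_unit tgt_unit.
  have := tmap_pairs z unit_sm unit_sm comp Fext.
  have -> : (fun z' => product Q (unit_map Q z') (unit_map Q z')) = unit_map Q.
    by apply: funext => z'; exact: mul_units.
  exact: esym.
have sx z : tmap (source Q) e (tmap (unit_map Q) b z) = z.
  by apply: tmap_cancel => //; [exact: source_smooth | exact: src_unit].
have tx z : tmap (target Q) e (tmap (unit_map Q) b z) = z.
  by apply: tmap_cancel => //; [exact: target_smooth | exact: tgt_unit].
have := mw e e F ee Fext (tmap (unit_map Q) b x) (tmap (unit_map Q) b x)
  (tmap (unit_map Q) b y) (tmap (unit_map Q) b y).
rewrite !sx !tx => /(_ erefl erefl) /=; rewrite !dF mul_units => e2.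
by apply: (addrI (ev w e (tmap (unit_map Q) b x) (tmap (unit_map Q) b y))); rewrite -e2 addr0.
Qed.

(** At a unit, u is the image of (u, 0) and v the image of (0, v) under the tangent map of the
    product, and both pairs are tangent to the composable pairs. *)
Lemma vertical_orthogonal b u v : let e := unit_map Q b in
  tmap (source Q) e u = 0 -> tmap (target Q) e v = 0 -> ev w e u v = 0.
Proof.
move=> e su tv; have [_ mw] := sQ.
have se : source Q e = b by rewrite src_unit.
have te : target Q e = b by rewrite tgt_unit.
have ee : source Q e = target Q e by rewrite se te.
have [F Fext] := mul_extension ee.
have dFu : 'd F (loc e e, loc e e) (u, 0) = u.
  have := @diff_mul_unit_right e F u; rewrite se -/e su tmap0; exact.
have dFv : 'd F (loc e e, loc e e) (0, v) = v.
  have := @diff_mul_unit_left e F v; rewrite te -/e tv tmap0; exact.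
have := mw e e F ee Fext u 0 0 v.
rewrite su tv !tmap0 => /(_ erefl erefl) /=; rewrite dFu dFv mul_units.
by rewrite ev0r ev0l addr0.
Qed.

(** Isotropy of the units bounds mdim B from above by half of mdim G, and orthogonality of the two
    kernels, of dimension mdim G - mdim B each, bounds it from below. *)
Lemma symplectic_groupoid_dim (b : B) : mdim G = (2 * mdim B)%N.
Proof.
pose e := unit_map Q b.
have fw : row_free (w e) by apply: symplectic_free; case: sQ.
have free_unit : row_free (tmx (unit_map Q) b).
  apply: tmx_free => x y; have sK := @tmap_cancel _ _ (unit_map Q) (source Q) b.
  move=> /(congr1 (tmap (source Q) e)).
  by rewrite !sK//; [exact: source_smooth|exact: src_unit|exact: source_smooth|exact: src_unit].
have le1 : (2 * mdim B <= mdim G)%N.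
  have := @orthogonal_rank _ _ _ (tmx (unit_map Q) b) _ (tmx (unit_map Q) b) fw.
  rewrite (eqP free_unit) addnn -mul2n; apply=> i j.
  by rewrite !row_tmx; exact: unit_isotropic.
have rS := eqP (tmx_full e (src_submersion Q)).
have rT := eqP (tmx_full e (tgt_submersion Q)).
have kS : \rank (kermx (tmx (source Q) e)) = (mdim G - mdim B)%N by rewrite mxrank_ker rS.
have kT : \rank (kermx (tmx (target Q) e)) = (mdim G - mdim B)%N by rewrite mxrank_ker rT.
have le2 : ((mdim G - mdim B) + (mdim G - mdim B) <= mdim G)%N.
  rewrite -[X in (X + _)%N]kS -[X in (_ + X)%N]kT; apply: (orthogonal_rank fw) => i j.
  have kerP (N : manifold R) (f : G -> N) p l : tmap f p (row l (kermx (tmx f p))) = 0.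
    by rewrite -mul_tmx; apply/sub_kermxP; exact: row_sub.
  exact: vertical_orthogonal (kerP _ _ _ _) (kerP _ _ _ _).
apply/eqP; rewrite eqn_leq le1 andbT.
have bG : (mdim B <= mdim G)%N by have := rank_leq_row (tmx (source Q) e); rewrite rS.
rewrite mul2n -addnn -{1}(subnK bG) leq_add2r.
by rewrite -(leq_add2l (mdim G - mdim B)) subnK.
Qed.

End Multiplicative.

Lemma mul_inverse_right (G B : manifold R) (Q : lie_groupoid G B) h g :
  source Q h = target Q g ->
  product Q g (inverse Q (product Q h g)) = inverse Q h.
Proof.
move=> hg; pose k := product Q h g.
have th : target Q k = target Q h by rewrite tgt_mul.
have hk : source Q (inverse Q h) = target Q k by rewrite src_inv th.
have kk : source Q k = target Q (inverse Q k) by rewrite tgt_inv.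
have := mul_unit_right Q (inverse Q h); rewrite src_inv -th -(mul_inv_right Q k).
rewrite mul_assoc// /k mul_assoc//; last by rewrite src_inv.
by rewrite mul_inv_left hg mul_unit_left.
Qed.

End SymplecticGroupoid.

(** * The foliation of the preimage of the units *)

Section DoubleGroupoid.
Variables (R : realType) (D H V M : manifold R).
Variables (Q : double_lie_groupoid D H V M) (w : tensor2 D).
Hypothesis sQ : symplectic_double_groupoid Q w.

Local Notation top := (top_gpd Q).
Local Notation left := (left_gpd Q).
Local Notation right := (right_gpd Q).
Local Notation bottom := (bottom_gpd Q).
Local Notation X := (unit_preimage Q).

Definition base (p : D) : M := source right (source top p).

(** The right translation of p by 1^V_x in the top groupoid. On X it behaves as an action of the
    bottom groupoid along [base], whose orbits are the candidate leaves. *)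
Definition act (p : D) (x : H) : D := product top p (unit_map left x).

Lemma source_top_unit_left x : source top (unit_map left x) = unit_map right (source bottom x).
Proof. by have [[_ _ h _ _] _ _ _ _] := top_homs Q. Qed.

Lemma target_top_unit_left x : target top (unit_map left x) = unit_map right (target bottom x).
Proof. by have [_ [_ _ h _ _] _ _ _] := top_homs Q. Qed.

Lemma source_bottom_left d : source bottom (source left d) = base d.
Proof. by have [[_ h _ _ _] _ _ _ _] := top_homs Q; rewrite /base; case: (h d) => ->. Qed.

Lemma unit_top_unit_right m : unit_map top (unit_map right m) = unit_map left (unit_map bottom m).
Proof. by have [_ _ [_ _ h _ _] _ _] := top_homs Q; rewrite h. Qed.

Lemma source_left_mul d e : source top d = target top e ->
  source left (product top d e) = product bottom (source left d) (source left e).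
Proof. by move=> de; have [_ _ _ _ [h _ _ _]] := top_homs Q; case: (h d e de). Qed.

Lemma unit_left_mul x y : source bottom x = target bottom y ->
  unit_map left (product bottom x y) = product top (unit_map left x) (unit_map left y).
Proof. by move=> xy; have [_ _ _ _ [_ h _ _]] := top_homs Q; exact: h. Qed.

Lemma unit_preimageE p : X p -> source top p = unit_map right (base p).
Proof. by move=> [m _ e]; rewrite /base -e src_unit. Qed.

Lemma act_composable p x : X p -> target bottom x = base p ->
  source top p = target top (unit_map left x).
Proof. by move=> /unit_preimageE -> <-; rewrite target_top_unit_left. Qed.

Lemma source_top_act p x : X p -> target bottom x = base p ->
  source top (act p x) = unit_map right (source bottom x).
Proof. by move=> Xp xp; rewrite /act src_mul ?source_top_unit_left//; exact: act_composable. Qed.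

Lemma act_unit_preimage p x : X p -> target bottom x = base p -> X (act p x).
Proof. by move=> Xp xp; exists (source bottom x) => //; rewrite source_top_act. Qed.

Lemma base_act p x : X p -> target bottom x = base p -> base (act p x) = source bottom x.
Proof. by move=> Xp xp; rewrite /base source_top_act// src_unit. Qed.

Lemma source_left_act p x : X p -> target bottom x = base p ->
  source left (act p x) = product bottom (source left p) x.
Proof.
by move=> Xp xp; rewrite /act source_left_mul ?src_unit//; exact: act_composable.
Qed.

Lemma act_act p x y : X p -> target bottom x = base p -> source bottom x = target bottom y ->
  act (act p x) y = act p (product bottom x y).
Proof.
move=> Xp xp xy; rewrite /act unit_left_mul// mul_assoc//; first exact: act_composable.
by rewrite source_top_unit_left target_top_unit_left xy.
Qed.

Lemma act_unit p : X p -> act p (unit_map bottom (base p)) = p.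
Proof.
by move=> Xp; rewrite /act -unit_top_unit_right -unit_preimageE// mul_unit_right.
Qed.

Lemma act_inverse_act p x y : X p -> target bottom x = base p -> target bottom y = base p ->
  act (act p x) (product bottom (inverse bottom x) y) = act p y.
Proof.
move=> Xp xp yp; have xy : source bottom (inverse bottom x) = target bottom y by rewrite src_inv xp.
rewrite act_act ?tgt_mul ?tgt_inv// mul_assoc ?tgt_inv// mul_inv_right xp -yp.
by rewrite mul_unit_left.
Qed.

(** On X, [shrink] translates d along its orbit until its image in H is a unit. Two points
    have the same image exactly when they lie on the same orbit (lemmas [shrink_act] and
    [shrink_eq]), so that the orbits are the fibres of a smooth map. *)
Definition shrink_arg (d : D) : D := unit_map left (inverse bottom (source left d)).
Definition shrink (d : D) : D := product top d (shrink_arg d).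

Lemma shrinkE d : shrink d = act d (inverse bottom (source left d)).
Proof. by []. Qed.

Lemma target_inverse_left d : target bottom (inverse bottom (source left d)) = base d.
Proof. by rewrite tgt_inv source_bottom_left. Qed.

Lemma shrink_composable d : X d -> source top d = target top (shrink_arg d).
Proof. by move=> Xd; apply: act_composable => //; exact: target_inverse_left. Qed.

Lemma shrink_act p x : X p -> target bottom x = base p -> shrink (act p x) = shrink p.
Proof.
move=> Xp xp; rewrite !shrinkE source_left_act//.
have hx : source bottom (source left p) = target bottom x by rewrite source_bottom_left.
rewrite act_act// ?tgt_inv ?src_mul//.
by rewrite mul_inverse_right.
Qed.

Lemma shrinkK d : X d -> act (shrink d) (source left d) = d.
Proof.
move=> Xd; rewrite shrinkE act_act ?target_inverse_left ?src_inv// mul_inv_left.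
by rewrite source_bottom_left act_unit.
Qed.

Lemma source_left_shrink d : X d ->
  source left (shrink d) = unit_map bottom (target bottom (source left d)).
Proof.
by move=> Xd; rewrite shrinkE source_left_act ?target_inverse_left// mul_inv_right.
Qed.

(** Both s and d are recovered from their common image by translations, see [shrinkK]. *)
Lemma shrink_eq s d : X s -> X d -> shrink d = shrink s ->
  exists2 x, target bottom x = base s & d = act s x.
Proof.
move=> Xs Xd ds.
have tt : target bottom (source left d) = target bottom (source left s).
  have := congr1 (source left) ds; rewrite !source_left_shrink//.
  by move=> /(congr1 (source bottom)); rewrite !src_unit.
have comp : source bottom (inverse bottom (source left s)) = target bottom (source left d).
  by rewrite src_inv.
exists (product bottom (inverse bottom (source left s)) (source left d)).
  by rewrite tgt_mul// target_inverse_left.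
by rewrite -[LHS]shrinkK// ds shrinkE act_act ?target_inverse_left.
Qed.

Let sub_top : submersion (source top) := src_submersion top.

Lemma shrink_arg_smooth : smooth shrink_arg.
Proof.
apply: (smooth_comp (f := inverse bottom \o source left)); last exact: unit_smooth.
by apply: smooth_comp; [exact: source_smooth | exact: inv_smooth].
Qed.

Lemma tangent_unit_preimage p : X p ->
  tangent X p = [set v | exists x : Tsp M, tmap (source top) p v = tmap (unit_map right) (base p) x].
Proof.
move=> Xp; apply: (tangent_preimage_section sub_top (unit_smooth right) (source_smooth right)).
  by move=> m; exact: src_unit.
exact: unit_preimageE.
Qed.

Section Leaf.
Variables (s : D) (L : manifold R) (i : L -> H).
Hypothesis Xs : X s.
Hypothesis si : smooth i.
Hypothesis inji : injective i.
Hypothesis ri : range i = target bottom @^-1` [set base s].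
Hypothesis ti : forall y, injective (tmap i y).
Hypothesis dimL : mdim L = (mdim H - mdim M)%N.

Definition leaf_map (y : L) : D := act s (i y).
Local Notation j := leaf_map.

Lemma leaf_target y : target bottom (i y) = base s.
Proof. by have : range i (i y) := imageT i y; rewrite ri. Qed.

Lemma leaf_composable y : composable top (s, unit_map left (i y)).
Proof. by apply: act_composable => //; exact: leaf_target. Qed.

Lemma leaf_map_smooth : smooth j.
Proof.
apply: (smooth_pairs (@mul_smooth _ _ _ top) (smooth_cst L s) _ leaf_composable).
by apply: smooth_comp; [exact: si | exact: unit_smooth].
Qed.

Lemma leaf_map_unit_preimage y : X (j y).
Proof. by apply: act_unit_preimage => //; exact: leaf_target. Qed.

Lemma base_leaf_map y : base (j y) = source bottom (i y).
Proof. by apply: base_act => //; exact: leaf_target. Qed.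

Lemma leaf_recover y :
  i y = product bottom (inverse bottom (source left s)) (source left (j y)).
Proof.
have hx : source bottom (source left s) = target bottom (i y).
  by rewrite source_bottom_left leaf_target.
rewrite source_left_act ?leaf_target// mul_assoc ?src_inv//.
by rewrite mul_inv_left hx mul_unit_left.
Qed.

Lemma leaf_map_inj : injective j.
Proof. by move=> y z jyz; apply: inji; rewrite leaf_recover jyz -leaf_recover. Qed.

Lemma leaf_tmap_inj y : injective (tmap j y).
Proof.
move=> u v juv; apply: (@ti y).
pose a := inverse bottom (source left s); pose b := source left \o j.
have sb : smooth b by apply: smooth_comp; [exact: leaf_map_smooth | exact: source_smooth].
have comp z : composable bottom (a, b z).
  rewrite /composable /a /b /= src_inv source_left_act ?leaf_target// tgt_mul//.
  by rewrite source_bottom_left leaf_target.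
have [F Fext] := mul_extension (comp y).
have iE : i = fun z => product bottom a (b z) by apply: funext => z; exact: leaf_recover.
have di x : tmap i y x = 'd F (loc a a, loc (b y) (b y)) (0, tmap (source left) (j y) (tmap j y x)).
  have := tmap_pairs x (smooth_cst L a) sb comp Fext.
  by rewrite -iE tmap_cst (tmap_comp _ _ leaf_map_smooth (source_smooth left)).
by rewrite !di juv.
Qed.

(** The map j is also z |-> p 1^V_(kap z) with p = j y and kap y a unit. Hence the vector
    tmap j y u is the image of (0, T1^V a) under the tangent map of the product at (p, 1), for some
    a. A vector v tangent to X is the image of (v, T1^H (Tr v)), with r the source of the top
    groupoid; here Tr v = T1^V x, and T1^H T1^V x = T1^V T1^H x. By multiplicativity the pairing
    reduces to that of two vectors tangent to the units of the left groupoid, which are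
    isotropic. *)
Lemma leaf_orthogonal y u v x :
  tmap (source top) (j y) v = tmap (unit_map right) (base (j y)) x ->
  ev w (j y) (tmap j y u) v = 0.
Proof.
move=> vx; pose p := j y; pose m := base p.
have Xp : X p := leaf_map_unit_preimage y.
have [[_ mw] leftQ] := sQ.
(* Moving the origin of the orbit from s to p makes y correspond to a unit. *)
pose kap z := product bottom (inverse bottom (i y)) (i z).
have kcomp z : composable bottom (inverse bottom (i y), i z).
  by rewrite /composable /= src_inv !leaf_target.
have skap : smooth kap.
  exact: (smooth_pairs (@mul_smooth _ _ _ bottom) (smooth_cst L _) si kcomp).
have tkap z : target bottom (kap z) = m.
  by rewrite /kap tgt_mul ?tgt_inv /m ?base_leaf_map//; exact: kcomp.
have kapy : kap y = unit_map bottom m.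
  by rewrite /kap mul_inv_left /m base_leaf_map.
pose b z := unit_map left (kap z).
have sb : smooth b by apply: (smooth_comp skap); exact: unit_smooth.
have comp z : composable top (p, b z) by apply: act_composable => //; exact: tkap.
have jE : j = fun z => product top p (b z).
  apply: funext => z; rewrite /b /kap -[RHS]/(act p _).
  by rewrite /p /j act_inverse_act ?leaf_target.
have be : b y = unit_map top (source top p).
  by rewrite /b kapy -unit_top_unit_right -unit_preimageE.
have [F Fext] := mul_extension (comp y).
have dj : tmap j y u = 'd F (loc p p, loc (b y) (b y)) (0, tmap b y u).
  by have := tmap_pairs u (smooth_cst L p) sb comp Fext; rewrite -jE tmap_cst.
pose v' := tmap (unit_map top) (source top p) (tmap (source top) p v).
have dv : 'd F (loc p p, loc (b y) (b y)) (v, v') = v.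
  by move: Fext; rewrite be => Fext; exact: diff_mul_unit_right Fext.
have c1 : tmap (source top) p 0 = tmap (target top) (b y) (tmap b y u).
  rewrite tmap0 -(tmap_comp _ _ sb (target_smooth top)).
  have -> : target top \o b = fun=> unit_map right m.
    by apply: funext => z; rewrite /= /b target_top_unit_left tkap.
  by rewrite tmap_cst.
have c2 : tmap (source top) p v = tmap (target top) (b y) v'.
  rewrite be /v' tmap_cancel//; [exact: unit_smooth|exact: target_smooth|exact: tgt_unit].
have v'E : v' = tmap (unit_map left) (kap y) (tmap (unit_map bottom) m x).
  rewrite /v' vx -/m (unit_preimageE Xp) -/m kapy.
  rewrite -(tmap_comp _ _ (unit_smooth right) (unit_smooth top)).
  rewrite -(tmap_comp _ _ (unit_smooth bottom) (unit_smooth left)).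
  have -> : unit_map top \o unit_map right = unit_map left \o unit_map bottom.
    by apply: funext => z; exact: unit_top_unit_right.
  by [].
have bE : tmap b y u = tmap (unit_map left) (kap y) (tmap kap y u).
  exact: (tmap_comp _ _ skap (unit_smooth left)).
have := mw p (b y) F (comp y) Fext 0 (tmap b y u) v v' c1 c2.
rewrite /= -dj dv ev0l add0r v'E bE (unit_isotropic leftQ).
have -> : product top p (b y) = p by rewrite be mul_unit_right.
by [].
Qed.

(** The image of the tangent map lies in TX and is orthogonal to TX; its dimension
    mdim H - mdim M is the codimension mdim V - mdim M of X, because mdim H = mdim V is half of
    mdim D. *)
Lemma leaf_tangent y : range (tmap j y) = characteristic w X (j y).
Proof.
have [topQ leftQ] := sQ.
have Xp := leaf_map_unit_preimage y.
have tj u : exists x, tmap (source top) (j y) (tmap j y u) = tmap (unit_map right) (base (j y)) x.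
  exists (tmap (source bottom \o i) y u).
  rewrite -(tmap_comp _ _ leaf_map_smooth (source_smooth top)).
  have -> : source top \o j = unit_map right \o (source bottom \o i).
    by apply: funext => z; rewrite /= source_top_act ?leaf_target.
  rewrite base_leaf_map tmap_comp//; last exact: unit_smooth.
  by apply: smooth_comp; [exact: si | exact: source_smooth].
apply/seteqP; split=> [_ [u _ <-]|u].
  split; first by rewrite tangent_unit_preimage.
  by move=> v; rewrite tangent_unit_preimage// => -[x vx]; exact: leaf_orthogonal vx.
move=> [_ uX].
have fw : row_free (w (j y)) by apply: symplectic_free; case: topQ.
have fB : row_free (tmx (unit_map right) (base (j y))).
  apply: tmx_free => x x' /(congr1 (tmap (source right) (unit_map right (base (j y))))).
  rewrite !tmap_cancel//; by [exact: unit_smooth|exact: source_smooth|exact: src_unit].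
have fJ : row_free (tmx j y) by apply: tmx_free; exact: leaf_tmap_inj.
have dims : mdim L = (mdim V - mdim M)%N.
  have := symplectic_groupoid_dim topQ (source top s).
  rewrite (symplectic_groupoid_dim leftQ (source left s)) => /eqP.
  by rewrite eqn_pmul2l// => /eqP <-.
have JW (u' : 'rV_(mdim L)) (y' : 'rV_(mdim D)) (x : 'rV_(mdim M)) :
    y' *m tmx (source top) (j y) = x *m tmx (unit_map right) (base (j y)) ->
    (u' *m tmx j y *m w (j y) *m y'^T) 0 0 = 0.
  by rewrite !mul_tmx => h; exact: (@leaf_orthogonal y u' y' x h).
have uW (y' : 'rV_(mdim D)) (x : 'rV_(mdim M)) :
    y' *m tmx (source top) (j y) = x *m tmx (unit_map right) (base (j y)) ->
    (u *m w (j y) *m y'^T) 0 0 = 0.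
  rewrite !mul_tmx => h; apply: uX.
  by rewrite tangent_unit_preimage//; exists x.
have [x ->] := @orthogonal_complement R _ _ _ _ (w (j y)) (tmx (source top) (j y))
  (tmx (unit_map right) (base (j y))) (tmx j y) fw (tmx_full _ sub_top) fB fJ dims
  JW u uW.
by rewrite mul_tmx; exists x.
Qed.

End Leaf.
End DoubleGroupoid.

Section Leaves.
Variables (R : realType) (D H V M : manifold R).
Variables (Q : double_lie_groupoid D H V M) (w : tensor2 D).
Hypothesis sQ : symplectic_double_groupoid Q w.

Local Notation top := (top_gpd Q).
Local Notation bottom := (bottom_gpd Q).
Local Notation X := (unit_preimage Q).

Lemma leaf_exists s : X s -> exists (L : manifold R) (j : L -> D),
  [/\ smooth j /\ injective j,
      range j = [set act Q s x | x in target bottom @^-1` [set base Q s]],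
      connected (target bottom @^-1` [set base Q s]) -> connected [set: L] &
      forall y, [/\ X (j y), injective (tmap j y) & range (tmap j y) = characteristic w X (j y)]].
Proof.
move=> Xs; have [L [i [dimL [si inji] ri conL ti]]] :=
  fibre_submanifold (base Q s) (tgt_submersion bottom).
have inj_ti y : injective (tmap i y) by case: (ti y).
exists L, (leaf_map Q s i); split=> //.
- by split; [exact: (leaf_map_smooth Xs si ri) | exact: (leaf_map_inj Xs inji ri)].
- by rewrite -ri image_comp.
- move=> y; split.
  + exact: (leaf_map_unit_preimage Xs ri).
  + exact: (leaf_tmap_inj Xs si ri inj_ti).
  + exact: (leaf_tangent sQ Xs si ri inj_ti dimL).
Qed.

Lemma shrink_extension q : X q ->
  exists F, local_extension (composable top) (product top) q (shrink_arg Q q) F.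
Proof. by move=> Xq; apply: mul_extension; exact: shrink_composable. Qed.

Lemma tmap_shrink (N : manifold R) (a : N -> D) F y q u :
  smooth a -> (forall z, X (a z)) -> a y = q ->
  local_extension (composable top) (product top) q (shrink_arg Q q) F ->
  tmap (shrink Q \o a) y u = 'd F (loc q q, loc (shrink_arg Q q) (shrink_arg Q q))
    (tmap a y u, tmap (shrink_arg Q) q (tmap a y u)).
Proof.
move=> sa Xa <- Fext; have ss := shrink_arg_smooth Q.
have sb : smooth (shrink_arg Q \o a) by exact: smooth_comp.
have comp z : composable top (a z, (shrink_arg Q \o a) z) by exact: shrink_composable (Xa z).
by have := tmap_pairs u sa sb comp Fext; rewrite (tmap_comp _ _ sa ss).
Qed.

Lemma shrink_smooth (N : manifold R) (a : N -> D) :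
  smooth a -> (forall z, X (a z)) -> smooth (shrink Q \o a).
Proof.
move=> sa Xa; apply: (smooth_pairs (@mul_smooth _ _ _ top) sa).
  by apply: smooth_comp; [exact: sa | exact: shrink_arg_smooth].
by move=> z; exact: shrink_composable (Xa z).
Qed.

(** The characteristic space at a y is tangent to the orbit through a y by [leaf_tangent], and
    [shrink] is constant on this orbit. *)
Lemma tmap_shrink_eq0 (N : manifold R) (a : N -> D) y u : smooth a -> (forall z, X (a z)) ->
  characteristic w X (a y) (tmap a y u) -> tmap (shrink Q \o a) y u = 0.
Proof.
move=> sa Xa Eau; have Xq := Xa y.
have [L [j [[sj _] rj _ Lj]]] := leaf_exists Xq.
have [y1 y1q] : exists y1, j y1 = a y.
  have : range j (a y).
    rewrite rj; exists (unit_map bottom (base Q (a y))); last exact: act_unit.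
    by rewrite /= tgt_unit.
  by move=> [y1 _ e]; exists y1.
have [_ _ rT] := Lj y1.
have [u1 u1E] : exists u1, tmap j y1 u1 = tmap a y u.
  move: Eau; rewrite -y1q -rT => -[u1 _ e]; by exists u1.
have Xj z : X (j z) by case: (Lj z).
have [F Fext] := shrink_extension Xq.
rewrite (tmap_shrink u sa Xa erefl Fext) -u1E -(tmap_shrink u1 sj Xj y1q Fext).
have -> : shrink Q \o j = fun=> shrink Q (a y).
  apply: funext => z; have : range j (j z) := imageT j z.
  by rewrite rj /= => -[x xb <-]; exact: shrink_act.
exact: tmap_cst.
Qed.

End Leaves.

Theorem lemma4p2 (R : realType) (D H V M : manifold R)
    (Q : double_lie_groupoid D H V M) (w : tensor2 D)
    (hw : symplectic_double_groupoid Q w)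
    (s : D) (hs : unit_preimage Q s)
    (hconn : connected
       (target (bottom_gpd Q) @^-1` [set source (right_gpd Q) (source (top_gpd Q) s)])) :
  is_leaf (unit_preimage Q) (characteristic w (unit_preimage Q)) s
    [set product (top_gpd Q) s (unit_map (left_gpd Q) x) | x in
       target (bottom_gpd Q) @^-1` [set source (right_gpd Q) (source (top_gpd Q) s)]].
Proof.
split.
- split.
    by move=> _ [x xb <-]; exact: act_unit_preimage.
  have [L [j [[sj injj] rj conL Lj]]] := leaf_exists hw hs.
  by exists L, j; split=> //; [exact: conL | move=> y; have [] := Lj y].
- exists (unit_map (bottom_gpd Q) (base Q s)); last exact: act_unit.
  by rewrite /= tgt_unit.
- move=> L' [L'X [L [j [conL sj _ rj Tj]]]] L's d L'd.
  have Xj z : unit_preimage Q (j z) by apply: L'X; rewrite -rj; exact: imageT.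
  move: L's L'd; rewrite -rj => -[y0 _ jy0] [z0 _ jz0].
  have d0 z u : tmap (shrink Q \o j) z u = 0.
    by apply: (tmap_shrink_eq0 hw sj Xj); rewrite -(Tj z).2; exact: imageT.
  have e := tmap0_constant y0 z0 conL (shrink_smooth sj Xj) d0.
  rewrite /= jy0 jz0 in e; have Xd : unit_preimage Q d by rewrite -jz0.
  by have [x xb ->] := shrink_eq hs Xd e; exists x.
Qed.
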